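(* Let $k$ be a field of characteristic zero, let $E$ be a $k$-vector space of dimension $2n$ with $n\geq 1$, let $H_2$ be a non-singular skew-symmetric metric on $E$, and let $Sp_{2n}$ be the symplectic group of $H_2$. With $w_\sigma$, $a_\sigma$, $S'_m$ and $r(\sigma)$ as defined in the context, put, for each $m>0$ and $[\sigma],[\sigma']\in S'_m$, $$\lambda_{\sigma\sigma'}=\frac{w_\sigma(a_{\sigma'})}{(2n)^{r(\sigma)}\cdot (2n)^{r(\sigma')}},\qquad (\lambda_{[\sigma]})_{[\sigma]\in S'_m}=(\lambda_{\sigma\sigma'})^{-1}_{[\sigma],[\sigma']\in S'_m}\cdot(1,\ldots,1).$$ Then the invariant integral on $Sp_{2n}$ is $$w_{Sp_{2n}}=1+\sum_{m>0}\ \sum_{[\sigma]\in S'_m}\lambda_{[\sigma]}\cdot\frac{w_\sigma}{(2n)^{r(\sigma)}} .$$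
   Context: The invariant integral $w_{Sp_{2n}}\in A_{Sp_{2n}}^*={\rm Hom}_k(A_{Sp_{2n}},k)$ is the unique $Sp_{2n}$-invariant linear form on the ring of functions $A_{Sp_{2n}}$ with $w_{Sp_{2n}}(1)=1$. Let $M_{2n}={\rm End}_k(E)$ be the affine variety of endomorphisms, $A_{M_{2n}}=\bigoplus_r S^r({\rm End}_k(E)^* )$ its ring of polynomial functions. Since $Sp_{2n}\subset M_{2n}$ is closed, $A_{Sp_{2n}}^*\subset A_{M_{2n}}^*$ (linear forms vanishing on the ideal of $Sp_{2n}$). One identifies $A_{M_{2n}}^*=\prod_r({\rm End}_k(E)^{\otimes r})^{S_r}=\prod_r S^r{\rm End}_k(E)$, where the symmetric tensor $T\otimes\overset{r}{\cdots}\otimes T$ ($T\in{\rm End}_k(E)$) is the linear form sending a homogeneous polynomial $p$ of degree $r$ to $p(T)$ and all other homogeneous components to $0$; here $S^r$ is embedded in the $r$-th tensor power by symmetrization $\frac1{r!}\sum_{\tau\in S_r}\tau$, and a bar denotes the class in $S^r$ (as a symmetric tensor, the symmetrization). The term $1$ of $w_{Sp_{2n}}$ is the unit of $S^0{\rm End}_k(E)=k$. Let $H^2\in E\otimes E$ be the skew-symmetric metric on $E^*$ dual to $H_2$, i.e. the metric on $E^*$ obtained by transporting $H_2$ through the polarity $E\simeq E^*$; in coordinates, $\sum_a H_{ab}H^{ac}=\delta_b^c$. For $\sigma\in S_m$ let $H^2_{1\sigma(1)}\otimes\cdots\otimes H^2_{m\sigma(m)}\in E^{\otimes 2m}$ be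 the tensor $\tau(H^2\otimes\overset{m}{\cdots}\otimes H^2)$, where $\tau\in S_{2m}$ is $\tau(2i-1)=2i-1$, $\tau(2i)=2\sigma(i)$; that is, the $i$-th copy of $H^2$ has its first index in position $2i-1$ and its second index in position $2\sigma(i)$. Define $$w_\sigma:=\overline{H_2\otimes\overset{m}{\cdots}\otimes H_2\otimes H^2_{1\sigma(1)}\otimes\cdots\otimes H^2_{m\sigma(m)}}\in S^{2m}{\rm End}_k(E),$$ where $E^{*\otimes 2m}\otimes E^{\otimes 2m}$ is identified with ${\rm End}_k(E)^{\otimes 2m}=(E^*\otimes E)^{\otimes 2m}$ by pairing the $j$-th factor $E^*$ with the $j$-th factor $E$ (and the $i$-th copy of $H_2$ occupies positions $2i-1,2i$ in this order). Define $a_\sigma\in S^{2m}({\rm End}_k(E)^* )$ by the same expression $\overline{H_2\otimes\cdots\otimes H_2\otimes H^2_{1\sigma(1)}\otimes\cdots\otimes H^2_{m\sigma(m)}}$, with $E^{*\otimes 2m}\otimes E^{\otimes 2m}$ now identified with $({\rm End}_k(E)^* )^{\otimes 2m}$, ${\rm End}_k(E)^*=(E^*\otimes E)^*=E\otimes E^*$; equivalently $a_\sigma$ is the homogeneous polynomial function of degree $2m$ on ${\rm End}_k(E)$ whose value at $T$ is the full contraction of $H_2^{\otimes m}\otimes H^2_{1\sigma(1)}\otimes\cdots\otimes H^2_{m\sigma(m)}$ with $T^{\otimes 2m}$. $w_\sigma(a_{\sigma'})$ is the value of the linear form $w_\sigma$ on $a_{\sigma'}$. Both $w_\sigma$ and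 $a_\sigma$ depend only on the conjugacy class $[\sigma]$. $S'_m$ is the set of conjugacy classes $[\sigma]$ of $S_m$ such that $\sigma$ is a product of disjoint cycles of order less than or equal to $n$ (where $\dim_k E=2n$), and $r(\sigma)$ is the number of disjoint cycles of $\sigma$ (including cycles of order $1$). *)

(* Defs.v *)
From HB Require Import structures.
From mathcomp Require Import all_boot all_order all_fingroup all_algebra.
From mathcomp.multinomials Require Import mpoly.

Set Implicit Arguments.
Unset Strict Implicit.
Unset Printing Implicit Defensive.

Import GRing.Theory.
Local Open Scope ring_scope.

(* Conventions.  A basis e of E being fixed, a vector of E is the column of   *)
(* its coordinates, an endomorphism T is the matrix with T e_j =              *)
(* \sum_i T i j e_i, and a bilinear form H is its Gram matrix H(e_i, e_j).    *)
(* The ring A_M of polynomial functions on End(E) is {mpoly k[N * N]}, the    *)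
(* variable of index mxvec_index i j being the function T |-> T i j.          *)

Definition gram (k : fieldType) (E : vectType k) (N : nat)
    (H : E -> E -> k) (e : N.-tuple E) : 'M[k]_N :=
  \matrix_(i, j) H (tnth e i) (tnth e j).

Section Symplectic.

Variables (k : fieldType) (N : nat) (H : 'M[k]_N).

Definition genX (B : comNzRingType) : 'M[{mpoly B[N * N]}]_N :=
  \matrix_(i, j) 'X_(mxvec_index i j).

(* The group scheme Sp through its B-points, and its ideal in A_M.            *)
Definition Sp_point (B : comAlgType k) (g : 'M[B]_N) : Prop :=
  let HB := map_mx (in_alg B) H in g^T *m HB *m g = HB.

Definition Sp_ideal (p : {mpoly k[N * N]}) : Prop :=
  let HA := map_mx (@mpolyC (N * N) k) H in
  exists Q : 'M[{mpoly k[N * N]}]_N,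
    p = \sum_(i < N) \sum_(j < N)
          Q i j * ((genX k)^T *m HA *m genX k - HA) i j.

(* The polynomial function T |-> p (g T), with coefficients in B.             *)
Definition translate (B : comAlgType k) (g : 'M[B]_N)
    (p : {mpoly k[N * N]}) : {mpoly B[N * N]} :=
  mmap (fun c : k => (c%:A : B)%:MP_[N * N])
       (fun l => mxvec (map_mx (@mpolyC (N * N) B) g *m genX B) 0 l) p.

(* The B-linear extension to B[X] of a k-linear form w on k[X].               *)
Definition scalar_ext (B : comAlgType k) (w : {mpoly k[N * N]} -> k)
    (q : {mpoly B[N * N]}) : B :=
  \sum_(u <- msupp q) w 'X_[u] *: q@_u.

(* Linear forms on A_Sp are the linear forms on A_M that vanish on Sp_ideal.  *)
Definition invariant_integral (w : {mpoly k[N * N]} -> k) : Prop :=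
  [/\ scalar w,
      forall p, Sp_ideal p -> w p = 0,
      forall (B : comAlgType k) (g : 'M[B]_N), Sp_point g ->
        forall p, scalar_ext w (translate g p) = (w p)%:A
    & w 1 = 1].

End Symplectic.

Section Tensors.

Variables (k : fieldType) (N : nat).

Definition mindex (r : nat) := {ffun 'I_r -> 'I_N}.

(* t : tensor r stands for the element                                        *)
(*   \sum_(b, a) t b a (e^(b 1) (x) e_(a 1)) (x) ... (x) (e^(b r) (x) e_(a r)) *)
(* either of End(E)^(x)r, where e^b (x) e_a is the elementary matrix with     *)
(* entry 1 in row a and column b, or of (End(E)^* )^(x)r, where e^b (x) e_a   *)
(* is the linear form T |-> T b a.                                            *)
Definition tensor (r : nat) := mindex r -> mindex r -> k.

Definition symmetrize r (t : tensor r) : tensor r := fun b a =>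
  (r`!%:R)^-1 * \sum_(s : 'S_r) t [ffun j => b (s j)] [ffun j => a (s j)].

(* The class in S^r(End(E)^* ) of a tensor of (End(E)^* )^(x)r.               *)
Definition tensor_poly r (t : tensor r) : {mpoly k[N * N]} :=
  \sum_(b : mindex r) \sum_(a : mindex r)
    t b a *: \prod_(j < r) 'X_(mxvec_index (b j) (a j)).

(* The monomial of the function T |-> \prod_j T (a j) (b j).                  *)
Definition mono r (b a : mindex r) : 'X_{1..N * N} :=
  (\sum_(j < r) U_(mxvec_index (a j) (b j)))%MM.

(* Linear form on A_M defined by a symmetric tensor t of End(E)^(x)r: the     *)
(* full contraction of t with the symmetric tensor of the degree r component  *)
(* of p, in which the coefficient of a monomial is evenly spread over the     *)
(* pairs (b, a) that represent it.                                            *)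
Definition tensor_form r (t : tensor r) (p : {mpoly k[N * N]}) : k :=
  \sum_(b : mindex r) \sum_(a : mindex r)
    t b a * (p@_(mono b a)
             / #|[set c : mindex r * mindex r | mono c.1 c.2 == mono b a]|%:R).

Definition tensor_pow r (T : 'M[k]_N) : tensor r := fun b a =>
  \prod_(j < r) T (a j) (b j).

End Tensors.

Section Series.

Variables (k : fieldType) (n : nat) (H : 'M[k]_(n.*2)).

(* Positions of the two indices of the i-th copy of a metric (counted from 0, *)
(* so that 2i and 2i + 1 are the usual 2i - 1 and 2i).                        *)
Definition pos1 m (i : 'I_m) : 'I_m.*2 :=
  Ordinal (etrans (ltn_double i m) (ltn_ord i)).
Definition pos2 m (i : 'I_m) : 'I_m.*2 :=
  Ordinal (etrans (ltn_Sdouble i m) (ltn_ord i)).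

(* Coordinates of G_{1 s(1)} (x) ... (x) G_{m s(m)}.                          *)
Definition metric_tensor (G : 'M[k]_(n.*2)) m (s : 'S_m)
    (c : mindex n.*2 m.*2) : k :=
  \prod_(i < m) G (c (pos1 i)) (c (pos2 (s i))).

(* The metric H^2 on E^*, see dual_metricE.                                   *)
Definition dual_metric : 'M[k]_(n.*2) := (invmx H)^T.

Definition Htensor m (s : 'S_m) : tensor k n.*2 m.*2 := fun b a =>
  metric_tensor H 1%g b * metric_tensor dual_metric s a.

Definition w_ m (s : 'S_m) : {mpoly k[n.*2 * n.*2]} -> k :=
  tensor_form (symmetrize (Htensor s)).

Definition a_ m (s : 'S_m) : {mpoly k[n.*2 * n.*2]} := tensor_poly (Htensor s).

Definition ncycles m (s : 'S_m) : nat := #|porbits s|.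

Definition Sprime m : {set {set 'S_m}} :=
  [set (s ^: [set: 'S_m])%g
    | s in [pred s : 'S_m | [forall C in porbits s, #|C| <= n]%N]].

(* The representative of a class is immaterial: see w_conj and a_conj.        *)
Definition rep m (i : 'I_#|Sprime m|) : 'S_m := repr (enum_val i).

Definition lambda_mx m : 'M[k]_#|Sprime m| :=
  \matrix_(i, j) (w_ (rep i) (a_ (rep j)) /
    ((n.*2)%:R ^+ ncycles (rep i) * (n.*2)%:R ^+ ncycles (rep j))).

Definition lambda m : 'cV[k]_#|Sprime m| := invmx (lambda_mx m) *m const_mx 1.

(* The form w_ (s : 'S_m) kills the polynomials of degree < 2m, hence all the *)
(* terms of the series with m >= msize p vanish at p.                         *)
Definition w_series (p : {mpoly k[n.*2 * n.*2]}) : k :=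
  p@_0%MM + \sum_(1 <= m < msize p) \sum_(i < #|Sprime m|)
    lambda m i 0 * (w_ (rep i) p / (n.*2)%:R ^+ ncycles (rep i)).

End Series.

Lemma dual_metricE (k : fieldType) (n : nat) (H : 'M[k]_(n.*2)) b c :
  H \in unitmx -> \sum_a H a b * dual_metric H a c = (b == c)%:R.
Proof.
move=> uH; have /matrixP/(_ b c) : H^T *m dual_metric H = 1%:M.
  by rewrite /dual_metric -trmx_mul mulVmx // trmx1.
by rewrite !mxE => <-; apply: eq_bigr => a _; rewrite !mxE.
Qed.

Lemma meval_tensor_poly (k : fieldType) (N r : nat) (t : tensor k N r)
    (T : 'M[k]_N) :
  (tensor_poly t).@[mxvec T 0] =
    \sum_b \sum_a t b a * \prod_(j < r) T (b j) (a j).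
Proof.
rewrite /tensor_poly rmorph_sum; apply: eq_bigr => b _ /=.
rewrite rmorph_sum; apply: eq_bigr => a _ /=.
rewrite mevalZ rmorph_prod; congr (_ * _); apply: eq_bigr => j _ /=.
by rewrite mevalXU mxvecE.
Qed.

Section ConjInvariance.

Variables (k : fieldType) (n : nat) (H : 'M[k]_(n.*2)) (m : nat).
Implicit Types s x : 'S_m.

Lemma half_lt (j : 'I_m.*2) : (j./2 < m)%N.
Proof. by rewrite ltn_half_double. Qed.

Definition pos_map x (j : 'I_m.*2) : 'I_m.*2 :=
  let i := x (Ordinal (half_lt j)) in if odd j then pos2 i else pos1 i.

Lemma pos_map1 x i : pos_map x (pos1 i) = pos1 (x i).
Proof.
rewrite /pos_map /= odd_double; congr (pos1 (x _)).
by apply: val_inj; rewrite /= doubleK.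
Qed.

Lemma pos_map2 x i : pos_map x (pos2 i) = pos2 (x i).
Proof.
rewrite /pos_map /= odd_double /=; congr (pos2 (x _)).
by apply: val_inj; rewrite /= uphalf_double.
Qed.

Lemma pos_cases (j : 'I_m.*2) : exists i, j = pos1 i \/ j = pos2 i.
Proof.
exists (Ordinal (half_lt j)); case: (boolP (odd j)) => oj; [right | left];
  by apply: val_inj; rewrite /= -[LHS]odd_double_half ?oj ?(negbTE oj).
Qed.

Lemma pos_mapK x : cancel (pos_map x) (pos_map x^-1%g).
Proof.
by move=> j; case: (pos_cases j) => i [->|->];
  rewrite ?(pos_map1, pos_map2) permK.
Qed.

Definition pos_perm x : 'S_m.*2 := perm (can_inj (pos_mapK x)).

Lemma metric_tensor_conj (G : 'M[k]_(n.*2)) s x c :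
  metric_tensor G (s ^ x)%g c = metric_tensor G s [ffun j => c (pos_perm x j)].
Proof.
rewrite /metric_tensor (reindex_inj (@perm_inj _ x)) /=.
by apply: eq_bigr => i _; rewrite permJ !ffunE !permE pos_map1 pos_map2.
Qed.

Lemma Htensor_conj s x b a : Htensor H (s ^ x)%g b a =
  Htensor H s [ffun j => b (pos_perm x j)] [ffun j => a (pos_perm x j)].
Proof. by rewrite /Htensor -{1}(conj1g x) !metric_tensor_conj. Qed.

Lemma w_conj s x : w_ H (s ^ x)%g =1 w_ H s.
Proof.
move=> p; rewrite /w_ /tensor_form; apply: eq_bigr => b _; apply: eq_bigr => a _.
congr (_ * _); rewrite /symmetrize; congr (_ * _).
rewrite [RHS](reindex_inj (mulgI (pos_perm x))) /=; apply: eq_bigr => t _.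
by rewrite Htensor_conj; congr Htensor; apply/ffunP => j; rewrite !ffunE permM.
Qed.

Lemma a_conj s x : a_ H (s ^ x)%g = a_ H s.
Proof.
pose f (c : mindex n.*2 m.*2) : mindex n.*2 m.*2 := [ffun j => c (pos_perm x j)].
have f_inj : injective f.
  move=> c d /ffunP cd; apply/ffunP => j.
  by have := cd ((pos_perm x)^-1%g j); rewrite !ffunE permKV.
rewrite /a_ /tensor_poly [RHS](reindex_inj f_inj) /=; apply: eq_bigr => b _.
rewrite [RHS](reindex_inj f_inj) /=; apply: eq_bigr => a _.
rewrite Htensor_conj; congr (_ *: _).
rewrite (reindex_inj (@perm_inj _ (pos_perm x))) /=.
by apply: eq_bigr => j _; rewrite !ffunE.
Qed.

End ConjInvariance.

Section TensorPow.

Variables (k : fieldType) (N r : nat).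

Lemma mono_surj (u : 'X_{1..N * N}) : mdeg u = r ->
  exists c : mindex N r * mindex N r, mono c.1 c.2 = u.
Proof.
move=> degu; have sz : size (m2s u) == r by rewrite size_m2s degu.
pose t := Tuple sz.
have /fin_all_exists2[f _ fP] : forall j : 'I_r, exists2 ij : 'I_N * 'I_N,
    true & mxvec_index ij.1 ij.2 = tnth t j.
  by move=> j; case/mxvec_indexP: (tnth t j) => i l; exists (i, l).
exists ([ffun j => (f j).2], [ffun j => (f j).1]) => /=.
rewrite /mono -[RHS]s2mK; apply/mnmP => i; rewrite mnm_sumE mnmE.
rewrite -[m2s u]/(val t) -sum1_count big_tuple [RHS]big_mkcond /=.
by apply: eq_bigr => j _; rewrite !ffunE fP mnm1E eq_sym; case: eqP.
Qed.

Lemma mdeg_mono (b a : mindex N r) : mdeg (mono b a) = r.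
Proof.
rewrite /mono mdeg_sum (eq_bigr (fun=> 1%N)) ?sum1_card ?card_ord //.
by move=> j _; rewrite mdeg1.
Qed.

Lemma tensor_powE (T : 'M[k]_N) (b a : mindex N r) :
  tensor_pow T b a = ('X_[mono b a]).@[mxvec T 0].
Proof.
rewrite /mono -mprodXE.
rewrite rmorph_prod; apply: eq_bigr => j _ /=.
by rewrite mevalXU mxvecE.
Qed.

(* The form T (x) ... (x) T is p |-> p_r(T), p_r being the component of       *)
(* degree r of p.                                                             *)
Lemma tensor_form_pow (T : 'M[k]_N) (p : {mpoly k[N * N]}) :
  [pchar k] =i pred0 ->
  tensor_form (tensor_pow (r := r) T) p =
    (pihomog mdeg r p).@[mxvec T 0].
Proof.
move=> /pcharf0P char0.
rewrite /tensor_form pair_bigA /= pihomogE rmorph_sum /=.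
pose F u := ('X_[u] : {mpoly k[N * N]}).@[mxvec T 0].
pose A u := [set c : mindex N r * mindex N r | mono c.1 c.2 == u].
transitivity (\sum_(c : mindex N r * mindex N r)
   \sum_(u <- msupp p | mono c.1 c.2 == u) F u * (p@_u / #|A u|%:R)).
  apply: eq_bigr => c _; rewrite tensor_powE -/(F _) -/(A _).
  have [mp|mp] := boolP (mono c.1 c.2 \in msupp p).
    rewrite [RHS]big_mkcond /= (bigD1_seq (mono c.1 c.2)) //= ?msupp_uniq //.
    by rewrite eqxx big1 ?addr0 // => u; rewrite eq_sym => /negbTE->.
  rewrite (memN_msupp_eq0 mp) mul0r mulr0 big_seq_cond big1 // => u.
  by case/andP=> up /eqP mu; rewrite mu up in mp.
rewrite (exchange_big_dep predT) //= [RHS]big_mkcond /=.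
apply: eq_bigr => u _; rewrite mevalZ -/(F u).
rewrite (eq_bigl (fun c => c \in A u)); last by move=> c; rewrite inE.
rewrite sumr_const -[LHS]mulr_natr mulrA mulrAC mulrC [F u * _]mulrC.
case: eqP => [du|du]; last first.
  suff /eqP -> : #|A u| == 0%N by rewrite mulr0 mulr0.
  rewrite cards_eq0; apply/eqP/setP => c; rewrite !inE.
  by apply/eqP => cu; rewrite -cu mdeg_mono in du.
have [c cu] := mono_surj du.
rewrite mulrC mulfK // char0 -lt0n.
by apply/card_gt0P; exists c; rewrite inE cu.
Qed.

End TensorPow.

(* Main.v *)
(* The integral of g (x) ... (x) g (2m factors) has to be the projector of     *)
(* E^(x)2m onto the span U of the tensors obtained from H^2 (x) ... (x) H^2    *)
(* by permuting the positions, along the annihilator of the corresponding      *)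
(* span U' of tensors made of H_2. It exists because the pairing of U' and U   *)
(* is nondegenerate: in a symplectic basis both are spanned by the same        *)
(* rational vectors, and a sum of squares is positive. Contracting two         *)
(* positions with H_2 maps U in degree 2m + 2 to U in degree 2m, so the form   *)
(* defined by the projectors vanishes on the ideal of Sp; as these lie in      *)
(* U' (x) U, the form is left and right invariant. It is unique: compare it    *)
(* with any other integral at the generic point of Sp, over A_M / I.           *)
(* The union of two perfect matchings consists of even cycles, which rewrites  *)
(* the projectors as combinations of the w_s. Antisymmetrization over more     *)
(* than 2n positions eliminates the s with a cycle of length > n, and the      *)
(* other w_s are independent because T^* T can have n arbitrary double         *)
(* eigenvalues, whose power sums are algebraically independent. The value      *)
(* (2n)^r(s) of the integral at a_s then determines the coefficients.          *)

Require Import Defs.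
From HB Require Import structures.
From mathcomp Require Import all_boot all_order all_fingroup all_algebra.
From mathcomp Require Import boolp.
From mathcomp.multinomials Require Import ssrcomplements mpoly.

Set Implicit Arguments.
Unset Strict Implicit.
Unset Printing Implicit Defensive.

Import GRing.Theory.
Local Open Scope ring_scope.

(** * Tensors attached to perfect matchings *)

(** The integral of the r-fold tensor power of [g] is the projector of the r-th tensor power of [E]
    onto its invariants: zero for odd r, and for r = 2m a combination of products of copies of [H]
    with copies of its dual [D], placed along pairs of perfect matchings of the 2m positions.
    [haar_tensor] axiomatizes this projector: [weingarten] supplies its coefficients and
    [haar_tensor_unique] shows that the axioms determine it. The form it defines kills the ideal of
    the group because the projectors of degrees 2m and 2m + 2 are compatible with contraction
    ([haar_tensor_contract]). It is invariant because [D] is. Two integrals agree because they can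
    be compared at the generic point of the group ([invariant_integral_unique]).

    It remains to expand the projector in the [w_ s]. After symmetrization, and up to sign, a pair
    of matchings is one of the [Htensor s] ([matching_normal_form]). Antisymmetrizing over the
    positions of a cycle longer than n gives zero, and this relation expresses [s] by permutations
    with more cycles, so the classes in [Sprime] span ([symmetrize_Htensor_span]). They are
    independent, since at a suitable endomorphism they become, up to powers of 2, distinct monomials
    in the first n power sums of n variables ([symmetrize_Htensor_free], [psums_free]). Independence
    and the projector together make the matrix of values of the [w_ s] at the [a_ s'] invertible
    ([w_a_nondegenerate]). The integral of [a_ s] is 2n to the number of cycles of [s] ([haar_a]);
    dividing by these powers turns the system for the coefficients into the one that defines
    [lambda] ([haar_form_lambda]). *)

Section Positions.

Variable m : nat.
Implicit Types (i : 'I_m) (s t : 'S_m) (j : 'I_m.*2).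

Lemma pos1_inj : injective (@pos1 m).
Proof. by move=> i i' /(congr1 val) /= /double_inj /val_inj. Qed.

Lemma pos2_inj : injective (@pos2 m).
Proof. by move=> i i' /(congr1 val) /= [/double_inj /val_inj]. Qed.

Lemma pos12_neq i i' : pos1 i != pos2 i'.
Proof. by apply/eqP => /(congr1 (odd \o val)) /=; rewrite !odd_double. Qed.

Lemma pos21_neq i i' : pos2 i != pos1 i'.
Proof. by rewrite eq_sym pos12_neq. Qed.

Definition half_pos j : 'I_m := Ordinal (half_lt j).

Lemma half_pos1 i : half_pos (pos1 i) = i.
Proof. by apply: val_inj; rewrite /= doubleK. Qed.

Lemma half_pos2 i : half_pos (pos2 i) = i.
Proof. by apply: val_inj; rewrite /= uphalf_double. Qed.

Lemma odd_pos1 i : odd (pos1 i) = false. Proof. exact: odd_double. Qed.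
Lemma odd_pos2 i : odd (pos2 i) = true. Proof. by rewrite /= odd_double. Qed.

Lemma posE j : j = if odd j then pos2 (half_pos j) else pos1 (half_pos j).
Proof.
by case: (pos_cases j) => i [] ->;
  rewrite ?odd_pos1 ?odd_pos2 ?half_pos1 ?half_pos2.
Qed.

Lemma big_pos (R : Type) (idx : R) (op : Monoid.com_law idx)
    (P : pred 'I_m.*2) (F : 'I_m.*2 -> R) :
  \big[op/idx]_(j | P j) F j =
  \big[op/idx]_(i < m) op (if P (pos1 i) then F (pos1 i) else idx)
                          (if P (pos2 i) then F (pos2 i) else idx).
Proof.
rewrite big_mkcond (bigID (fun j : 'I_m.*2 => odd j)) /= Monoid.mulmC.
rewrite big_split /=; congr (op _ _).
- rewrite (reindex_onto (@pos1 m) half_pos) /= => [|j /negbTE oj].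
    by apply: eq_bigl => i; rewrite odd_double half_pos1 eqxx.
  by rewrite {2}[j]posE oj.
- rewrite (reindex_onto (@pos2 m) half_pos) /= => [|j oj].
    by apply: eq_bigl => i; rewrite odd_double half_pos2 eqxx.
  by rewrite {2}[j]posE oj.
Qed.

Lemma prod_pos (R : comNzRingType) (x : 'S_m.*2) (F : 'I_m.*2 -> R) :
  \prod_j F j = \prod_(i < m) (F (x (pos1 i)) * F (x (pos2 i))).
Proof. by rewrite (reindex_inj (@perm_inj _ x)) big_pos. Qed.

(** Permutations acting separately on first and second indices: [bipos 1 s] is the placement of the
    copies of [H^2] in [w_s], while [bipos s s] only renumbers the copies of a metric. *)
Definition bipos_map s t j : 'I_m.*2 :=
  if odd j then pos2 (t (half_pos j)) else pos1 (s (half_pos j)).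

Lemma bipos_mapK s t : cancel (bipos_map s t) (bipos_map s^-1%g t^-1%g).
Proof.
move=> j; case: (pos_cases j) => i [] ->; rewrite /bipos_map.
  by rewrite odd_pos1 half_pos1 odd_pos1 half_pos1 permK.
by rewrite odd_pos2 half_pos2 odd_pos2 half_pos2 permK.
Qed.

Definition bipos s t : 'S_m.*2 := perm (can_inj (bipos_mapK s t)).

Lemma bipos1 s t i : bipos s t (pos1 i) = pos1 (s i).
Proof. by rewrite permE /bipos_map odd_pos1 half_pos1. Qed.

Lemma bipos2 s t i : bipos s t (pos2 i) = pos2 (t i).
Proof. by rewrite permE /bipos_map odd_pos2 half_pos2. Qed.

Lemma pos_permP (x y : 'S_m.*2) :
    (forall i, x (pos1 i) = y (pos1 i)) -> (forall i, x (pos2 i) = y (pos2 i)) ->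
  x = y.
Proof.
by move=> e1 e2; apply/permP => j; case: (pos_cases j) => i [] ->.
Qed.

Lemma biposM s t s' t' : (bipos s t * bipos s' t' = bipos (s * s') (t * t'))%g.
Proof. by apply: pos_permP => i; rewrite permM ?bipos1 ?bipos2 permM. Qed.

Lemma bipos_id : bipos 1 1 = 1%g.
Proof. by apply: pos_permP => i; rewrite ?bipos1 ?bipos2 !perm1. Qed.

Lemma odd_bipos s t : odd_perm (bipos s t) = odd_perm s (+) odd_perm t.
Proof.
have bip1 a b : bipos (tperm a b) 1 = tperm (pos1 a) (pos1 b).
  apply: pos_permP => i; rewrite ?bipos1 ?bipos2.
    case: (tpermP a b i) => [->|->|/eqP ia /eqP ib]; rewrite ?tpermL ?tpermR //.
    by rewrite tpermD // (inj_eq pos1_inj) eq_sym.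
  by rewrite perm1 tpermD // pos12_neq.
have bip2 a b : bipos 1 (tperm a b) = tperm (pos2 a) (pos2 b).
  apply: pos_permP => i; rewrite ?bipos1 ?bipos2.
    by rewrite perm1 tpermD // pos21_neq.
  case: (tpermP a b i) => [->|->|/eqP ia /eqP ib]; rewrite ?tpermL ?tpermR //.
  by rewrite tpermD // (inj_eq pos2_inj) eq_sym.
have m1 a b : bipos (a * b) 1 = (bipos a 1 * bipos b 1)%g by rewrite biposM mulg1.
have m2 a b : bipos 1 (a * b) = (bipos 1 a * bipos 1 b)%g by rewrite biposM mulg1.
have -> : bipos s t = (bipos s 1 * bipos 1 t)%g by rewrite biposM mulg1 mul1g.
rewrite odd_permM; congr (_ (+) _).
- case: (prod_tpermP s) => ts -> _; elim: ts => [|[a b] ts IH].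
    by rewrite big_nil bipos_id !odd_perm1.
  rewrite big_cons m1 !odd_permM IH bip1 /=.
  by rewrite !odd_tperm (inj_eq pos1_inj).
- case: (prod_tpermP t) => ts -> _; elim: ts => [|[a b] ts IH].
    by rewrite big_nil bipos_id !odd_perm1.
  rewrite big_cons m2 !odd_permM IH bip2 /=.
  by rewrite !odd_tperm (inj_eq pos2_inj).
Qed.

End Positions.

(** * Action of matrices on tensors, and tensors of matchings *)

Section TensorAction.

Variables (R : comNzRingType) (N r : nat).
Implicit Types (A B : 'M[R]_N) (u v : mindex N r -> R).

Definition tact A v (c : mindex N r) : R :=
  \sum_(d : mindex N r) (\prod_(j < r) A (c j) (d j)) * v d.

Definition tdot u v : R := \sum_(c : mindex N r) u c * v c.

Lemma eq_tact A u v : u =1 v -> tact A u =1 tact A v.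
Proof. by move=> uv c; apply: eq_bigr => d _; rewrite uv. Qed.

Lemma eq_tdot u u' v v' : u =1 u' -> v =1 v' -> tdot u v = tdot u' v'.
Proof. by move=> uu vv; apply: eq_bigr => d _; rewrite uu vv. Qed.

Lemma tdot_act A u v : tdot (tact A u) v = tdot u (tact A^T v).
Proof.
rewrite /tdot /tact.
under eq_bigr do rewrite mulr_suml.
rewrite exchange_big; apply: eq_bigr => d _ /=.
rewrite mulr_sumr; apply: eq_bigr => c _.
rewrite mulrAC mulrA [u d * _]mulrC mulrAC; congr (_ * _ * _).
by apply: eq_bigr => j _; rewrite mxE.
Qed.

Lemma tactM A B v : tact A (tact B v) =1 tact (A *m B) v.
Proof.
move=> c; rewrite /tact.
under eq_bigr do rewrite mulr_sumr.
rewrite exchange_big; apply: eq_bigr => e _ /=.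
under eq_bigr do rewrite mulrA -big_split.
rewrite -mulr_suml; congr (_ * _).
under [RHS]eq_bigr do rewrite mxE.
by rewrite bigA_distr_bigA.
Qed.

Lemma tact1 v : tact 1%:M v =1 v.
Proof.
move=> c; rewrite /tact (bigD1 c) //= [X in _ + X]big1 => [|d dc].
  by rewrite big1 ?mul1r ?addr0 // => j _; rewrite mxE eqxx.
have [j cdj] : exists j, c j != d j.
  apply/existsP; rewrite -negb_forall; apply: contra dc => /forallP cd.
  by apply/eqP/ffunP => j; rewrite (eqP (cd j)).
by rewrite (bigD1 j) //= mxE (negbTE cdj) !mul0r.
Qed.

End TensorAction.

Section MatchingTensors.

Variables (R : comNzRingType) (N m : nat).
Implicit Types (G A : 'M[R]_N) (x y : 'S_m.*2) (c d : mindex N m.*2).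

(* The tensor G (x) ... (x) G, the i-th copy of G having its indices in the   *)
(* positions x (2i) and x (2i + 1): it is determined up to sign by a perfect  *)
(* matching of the 2m positions when G is skew-symmetric.                     *)
Definition mtensor G x c : R := \prod_(i < m) G (c (x (pos1 i))) (c (x (pos2 i))).

(** The matching cuts a multi-index into m independent pairs of indices, so the sum factors. *)
Lemma sum_mtensor x (F : 'I_m -> 'I_N -> 'I_N -> R) :
  \sum_(c : mindex N m.*2) \prod_(i < m) F i (c (x (pos1 i))) (c (x (pos2 i))) =
  \prod_(i < m) \sum_p \sum_q F i p q.
Proof.
under [RHS]eq_bigr do rewrite pair_bigA /=.
rewrite bigA_distr_bigA /=.
pose f (e : {ffun 'I_m -> 'I_N * 'I_N}) : mindex N m.*2 :=
  [ffun j => if odd ((x^-1)%g j) then (e (half_pos ((x^-1)%g j))).2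
             else (e (half_pos ((x^-1)%g j))).1].
pose g c := [ffun i : 'I_m => (c (x (pos1 i)), c (x (pos2 i)))].
rewrite [LHS](reindex f); last first.
  exists g => [e _|c _].
    apply/ffunP => i; rewrite !ffunE !permK.
    by rewrite odd_pos1 odd_pos2 half_pos1 half_pos2; case: (e i).
  apply/ffunP => j; rewrite !ffunE -[in RHS](permKV x j).
  by rewrite [in RHS](posE ((x^-1)%g j)); case: ifP.
apply: eq_bigr => e _; apply: eq_bigr => i _; rewrite !ffunE !permK.
by rewrite odd_pos1 odd_pos2 half_pos1 half_pos2.
Qed.

(** Each copy of [G] is transformed by congruence. This serves for changes of basis as well as for
    the action of points of the group. *)
Lemma tact_mtensor A G x :
  tact A (mtensor G x) =1 mtensor (A *m G *m A^T) x.
Proof.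
move=> c; rewrite /tact /mtensor.
under eq_bigr => d _ do rewrite (prod_pos x) -big_split /=.
rewrite (sum_mtensor x (fun i p q =>
  A (c (x (pos1 i))) p * A (c (x (pos2 i))) q * G p q)).
apply: eq_bigr => i _; rewrite !mxE exchange_big; apply: eq_bigr => q _ /=.
rewrite !mxE mulr_suml; apply: eq_bigr => p _ /=; rewrite mulrAC.
by congr (_ * _); rewrite mulrC mulrC.
Qed.

Lemma mtensor_perm G x (z : 'S_m.*2) c :
  mtensor G x [ffun j => c (z j)] = mtensor G (x * z)%g c.
Proof. by apply: eq_bigr => i _; rewrite !ffunE !permM. Qed.

Lemma mtensor_bipos G x s c : mtensor G (bipos s s * x) c = mtensor G x c.
Proof.
rewrite [RHS](reindex_inj (@perm_inj _ s)).
by apply: eq_bigr => i _; rewrite !permM bipos1 bipos2.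
Qed.

Lemma mtensor_flip G x i c : G^T = - G ->
  mtensor G (tperm (pos1 i) (pos2 i) * x) c = - mtensor G x c.
Proof.
move=> skG; rewrite /mtensor (bigD1 i) // [in RHS](bigD1 i) //= !permM.
rewrite tpermL tpermR -mulNr; congr (_ * _).
  by have /matrixP/(_ (c (x (pos1 i))) (c (x (pos2 i)))) := skG; rewrite !mxE.
apply: eq_bigr => j ji; rewrite !permM !tpermD ?pos12_neq ?pos21_neq //.
  by rewrite (inj_eq (@pos2_inj m)) eq_sym.
by rewrite (inj_eq (@pos1_inj m)) eq_sym.
Qed.

End MatchingTensors.

Lemma metric_tensorE (k : fieldType) (n m : nat) (G : 'M[k]_(n.*2)) (s : 'S_m) c :
  metric_tensor G s c = mtensor G (bipos 1 s) c.
Proof. by apply: eq_bigr => i _; rewrite bipos1 bipos2 perm1. Qed.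

(** * Symplectic bases and the projector onto the invariants *)

Section SymplecticBasis.

Variable n : nat.

(** The standard symplectic form, with the coordinates 2l and 2l + 1 as l-th hyperbolic pair. Its
    entries are integers and it is orthogonal, hence equal to its own dual metric. *)
Definition Jmx (R : nzRingType) : 'M[R]_(n.*2) :=
  \matrix_(i, j) if half_pos i == half_pos j then (odd j)%:R - (odd i)%:R else 0.

Lemma Jmx_map (R S : nzRingType) (f : {rmorphism R -> S}) :
  map_mx f (Jmx R) = Jmx S.
Proof.
by apply/matrixP => i j; rewrite !mxE; case: ifP;
  rewrite ?rmorph0 // rmorphB !rmorph_nat.
Qed.

Lemma Jmx_orth (R : comNzRingType) : Jmx R *m (Jmx R)^T = 1%:M.
Proof.
apply/matrixP => i j; rewrite !mxE big_pos /=.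
under eq_bigr do rewrite !mxE !half_pos1 !half_pos2 !odd_double /=.
have E a b c d : ((if a == b then c else 0) * (if d == b then c else 0) : R) =
    if a == b then (c * c) * (a == d)%:R else 0.
  rewrite [d == b]eq_sym; case: eqP => [<-|]; rewrite ?mul0r //.
  by case: eqP; rewrite ?mulr1 ?mulr0.
have sgn (b c : bool) : (0 - b%:R) * (0 - c%:R) + (1 - b%:R) * (1 - c%:R) =
   (b == c)%:R :> R.
  by case: b c => [] []; rewrite /= ?subr0 ?subrr ?sub0r ?mul0r ?mulr0 ?mulrNN ?mulr1 ?addr0 ?add0r.
transitivity ((half_pos i == half_pos j)%:R * (odd i == odd j)%:R : R).
  rewrite (bigD1 (half_pos i)) //= big1 => [|a /negbTE ai]; last first.
    by rewrite eq_sym ai !mul0r addr0.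
  rewrite addr0 eqxx [half_pos j == _]eq_sym; case: eqP => _.
    by rewrite mul1r -sgn odd_double.
  by rewrite !mulr0 mul0r addr0.
rewrite -natrM mulnb; congr (_%:R); congr nat_of_bool.
apply/andP/eqP => [[/eqP hij /eqP oij]|-> //].
by rewrite (posE i) (posE j) hij oij.
Qed.

Lemma Jmx_dual (R : comUnitRingType) : (invmx (Jmx R))^T = Jmx R.
Proof.
have uJ : Jmx R \in unitmx by have /mulmx1_unit[] := Jmx_orth R.
have -> : invmx (Jmx R) = (Jmx R)^T.
  by rewrite -[LHS]mulmx1 -Jmx_orth mulKmx.
by rewrite trmxK.
Qed.

End SymplecticBasis.

(** Hyperbolic pairs are added one at a time: as long as fewer than n are present, some nonzero [v]
    is orthogonal to all of them, and a partner of [v] exists by nondegeneracy. *)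
Lemma symplectic_basis (k : fieldType) (n : nat) (H : 'M[k]_(n.*2)) :
    2%:R != 0 :> k -> H^T = - H -> H \in unitmx ->
  exists2 P : 'M[k]_(n.*2), P \in unitmx & P *m H *m P^T = Jmx n k.
Proof.
move=> two_neq0 skH uH.
have H_alt (v : 'rV[k]_(n.*2)) : (v *m H *m v^T) 0 0 = 0.
  have : (v *m H *m v^T)^T = - (v *m H *m v^T).
    by rewrite !trmx_mul trmxK skH mulmxA mulmxN mulNmx.
  move/matrixP/(_ 0 0); rewrite !mxE => /eqP.
  by rewrite -addr_eq0 -mulr2n -mulr_natl mulf_eq0 (negbTE two_neq0) => /eqP.
have H_skew (u v : 'rV[k]_(n.*2)) :
    (u *m H *m v^T) 0 0 = - (v *m H *m u^T) 0 0.
  have : (u *m H *m v^T)^T = - (v *m H *m u^T).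
    by rewrite !trmx_mul trmxK skH mulmxA mulmxN mulNmx.
  by move/matrixP/(_ 0 0); rewrite mxE => ->; rewrite mxE.
suff /(_ n (leqnn n)) [P PHP] : forall m, (m <= n)%N ->
    exists P : 'M[k]_(m.*2, n.*2), P *m H *m P^T = Jmx m k.
  exists P => //; have: P *m (H *m P^T *m (Jmx n k)^T) = 1%:M.
    by rewrite 2!mulmxA PHP Jmx_orth.
  by case/mulmx1_unit.
elim=> [|m IH] mn; first by exists 0; apply/matrixP => - [].
have [P PHP] := IH (ltnW mn).
have [v v0 vHP] : exists2 v : 'rV[k]_(n.*2), v != 0 & v *m (H *m P^T) = 0.
  have: kermx (H *m P^T) != 0.
    rewrite -mxrank_eq0 mxrank_ker subn_eq0 -ltnNge.
    by apply: leq_ltn_trans (rank_leq_col _) _; rewrite ltn_double.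
  case/rowV0Pn => v /sub_kermxP vK v0; by exists v.
have [w0 vw0] : exists w0 : 'rV[k]_(n.*2), (v *m H *m w0^T) 0 0 = 1.
  have: v *m H != 0.
    by apply: contraNneq v0 => vH; rewrite -[v](mulmxK uH) vH mul0mx.
  case/rV0Pn => j vj; exists (((v *m H) 0 j)^-1 *: delta_mx 0 j).
  rewrite linearZ /= -scalemxAr trmx_delta -colE mxE.
  by rewrite [col _ _ _ _]mxE mulVf.
(* The orthogonal projection onto the span of the rows of [P], whose Gram matrix [Jmx] has its
   transpose as inverse, is removed from [w0]. *)
pose w := w0 - w0 *m H *m P^T *m (Jmx m k)^T *m P.
have wHP : w *m H *m P^T = 0.
  rewrite /w !mulmxBl -!mulmxA (mulmxA P) PHP.
  by rewrite (mulmx1C (Jmx_orth m k)) mulmx1 subrr.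
have vw : (v *m H *m w^T) 0 0 = 1.
  rewrite /w linearB /= mulmxBr mxE vw0 mxE trmx_mul mulmxA.
  by rewrite -[v *m H *m P^T]mulmxA vHP mul0mx mxE subr0.
have entryE r (A : 'M[k]_(r, n.*2)) i j :
    (A *m H *m A^T) i j = (row i A *m H *m (row j A)^T) 0 0.
  by rewrite -row_mul [LHS]mxE [RHS]mxE; apply: eq_bigr => c _; rewrite !mxE.
pose A := \matrix_(j < m.+1.*2) (if unlift ord_max (half_pos j) is Some l
  then row (if odd j then pos2 l else pos1 l) P else if odd j then w else v).
exists A; apply/matrixP => i j; rewrite entryE !rowK [RHS]mxE.
have orth (u : 'rV_(n.*2)) (l : 'I_m.*2) : u *m H *m P^T = 0 ->
    (u *m H *m (row l P)^T) 0 0 = 0.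
  move=> uP; rewrite tr_row.
  by move/matrixP/(_ 0 l): uP; rewrite !mxE => uP; rewrite -[RHS]uP; apply: eq_bigr => c _; rewrite !mxE.
case: unliftP => [a ->|->]; case: unliftP => [b ->|->].
- rewrite -entryE PHP mxE (inj_eq lift_inj).
  by case: (odd i); case: (odd j); rewrite ?half_pos1 ?half_pos2 /= ?odd_double.
- rewrite [_ == _]eq_sym (negbTE (neq_lift _ _)) H_skew orth ?oppr0 //.
  by case: (odd j) => //; rewrite -mulmxA vHP.
- rewrite (negbTE (neq_lift _ _)) orth //.
  by case: (odd i) => //; rewrite -mulmxA vHP.
- rewrite eqxx.
  case: (odd i); case: (odd j); rewrite ?H_alt ?subrr // ?subr0 ?vw //.
  by rewrite H_skew vw sub0r.
Qed.

(* Positivity of the sum of squares makes A *m A^T and A^T have the same row  *)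
(* space.                                                                     *)
Lemma gram_pinv (r s : nat) (A : 'M[rat]_(r, s)) :
  exists2 C : 'M[rat]_r, C^T = C & A^T *m C *m (A *m A^T) = A^T.
Proof.
pose G := A *m A^T.
have symG : G^T = G by rewrite /G trmx_mul trmxK.
have /submxP[Y AY] : (A^T <= G)%MS.
  (* The diagonal entries of [B^T *m B = 0] are the sums of squares of the columns of [B]. *)
  rewrite submxE; set K := cokermx G; set B := A^T *m K.
  have BB : B^T *m B = 0.
    by rewrite /B trmx_mul trmxK -mulmxA (mulmxA A) -/G mulmx_coker mulmx0.
  apply/eqP/matrixP => i j; move/matrixP/(_ j j): BB.
  rewrite mxE [RHS]mxE => /Num.Theory.psumr_eq0P => /(_ _ i isT)/eqP.
  rewrite [B^T _ _]mxE mulf_eq0 orbb => BB; rewrite [RHS]mxE; apply/eqP/BB => l _.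
  by rewrite [B^T _ _]mxE -expr2 Num.Theory.sqr_ge0.
have AYt : A = G *m Y^T by rewrite -[LHS]trmxK AY trmx_mul symG.
have YAs : Y *m A = A^T *m Y^T.
  by rewrite {1}AYt (mulmxA Y) -AY.
exists (Y^T *m Y); first by rewrite trmx_mul trmxK.
by rewrite -/G (mulmxA A^T) -YAs -(mulmxA _ Y) -AY -mulmxA -/G -AY.
Qed.

Lemma clear_denominators (T : finType) (f : T -> rat) :
  exists2 d : int, d != 0 & exists g : T -> int, forall t, d%:~R * f t = (g t)%:~R.
Proof.
exists (\prod_t denq (f t)); first by apply/prodf_neq0 => t _; rewrite denq_neq0.
exists (fun t => (\prod_(s | s != t) denq (f s)) * numq (f t)) => t.
rewrite (bigD1 t) //= !rmorphM /= mulrAC mulrC; congr (_ * _).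
by rewrite mulrC -{1}[f t]divq_num_den divfK // intr_eq0 denq_neq0.
Qed.

(** An identity between integers can be mapped to any field of characteristic zero, where [d] stays
    invertible. *)
Lemma gram_pinv_int (S M : finType) (u : S -> M -> int) :
  exists2 d : int, d != 0 & exists2 Z : S -> S -> int, forall y z, Z y z = Z z y &
    forall x c, \sum_y \sum_z Z y z * (\sum_e u z e * u x e) * u y c = d * u x c.
Proof.
pose A : 'M[rat]_(#|S|, #|M|) := \matrix_(i, j) (u (enum_val i) (enum_val j))%:~R.
have [C symC AC] := gram_pinv A.
have [d d0 [g gE]] := clear_denominators (fun yz : 'I_#|S| * 'I_#|S| => C yz.1 yz.2).
exists d => //; exists (fun y z => g (enum_rank y, enum_rank z)) => [y z|x c].
  apply/eqP; rewrite -(eqr_int rat) -!gE /=.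
  by rewrite -[in X in X == _]symC mxE.
apply/eqP; rewrite -(eqr_int rat) rmorphM /= rmorph_sum /=; apply/eqP.
move/matrixP/(_ (enum_rank c) (enum_rank x)): AC.
rewrite [in X in _ = X -> _]mxE [in X in _ = X -> _]mxE !enum_rankK => <-.
have reix (T : finType) (F : 'I_#|T| -> rat) : \sum_i F i = \sum_t F (enum_rank t).
  by rewrite (reindex (@enum_rank T)) //; apply/onW_bij/enum_rank_bij.
rewrite mxE mulr_sumr reix; under [LHS]eq_bigr do rewrite rmorph_sum.
rewrite exchange_big; apply: eq_bigr => z _ /=.
rewrite [(A^T *m _) _ _]mxE reix mulrA mulr_sumr mulr_suml.
apply: eq_bigr => y _ /=.
rewrite [(A *m _) _ _]mxE reix [A^T _ _]mxE [A _ _]mxE !enum_rankK.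
rewrite !rmorphM /= -gE rmorph_sum /= [in RHS](mulrC _ (C _ _)) mulrA [RHS]mulrAC.
congr (_ * _ * _); apply: eq_bigr => e _.
by rewrite !mxE !enum_rankK rmorphM.
Qed.

(** * Coefficients of the projector *)

Section Weingarten.

Variables (k : fieldType) (n : nat) (H : 'M[k]_(n.*2)).
Hypotheses (char_k : [pchar k] =i pred0) (skH : H^T = - H) (uH : H \in unitmx).

Let D := dual_metric H.

Lemma dual_skew : D^T = - D.
Proof.
have uNH : - H \in unitmx by rewrite -skH unitmx_tr.
rewrite /D /dual_metric trmxK trmx_inv skH.
have E : H *m invmx H = - (- H *m invmx H) by rewrite mulNmx opprK.
by rewrite -[X in - X]mulmx1 -(mulmxV uH) E mulmxN opprK mulKmx.
Qed.

Lemma two_neq0 : 2%:R != 0 :> k.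
Proof. by rewrite ((pcharf0P k).1 char_k). Qed.

Lemma symplectic_metric (P : 'M[k]_(n.*2)) :
    P \in unitmx -> P *m H *m P^T = Jmx n k ->
  H = invmx P *m Jmx n k *m (invmx P)^T /\ D = P^T *m Jmx n k *m P.
Proof.
move=> uP PHP; set J := Jmx n k.
have HE : H = invmx P *m J *m (invmx P)^T.
  rewrite /J -PHP !mulmxA mulVmx // mul1mx -mulmxA -trmx_mul mulVmx //.
  by rewrite trmx1 mulmx1.
split=> //; have uJ : J \in unitmx by have /mulmx1_unit[] := Jmx_orth n k.
rewrite -{2}[P]trmxK /D /dual_metric -{1}[J]Jmx_dual -!trmx_mul; congr _^T.
rewrite -[RHS](mulKmx uH) -[LHS]mulmx1; congr (_ *m _).
rewrite HE -!mulmxA (mulmxA _ P^T) -trmx_mul mulmxV // trmx1 mul1mx.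
by rewrite (mulmxA J) mulmxV // mul1mx mulVmx.
Qed.

(** In a symplectic basis [H] and [D] have the same matrix [Jmx], so the pairing of the two families
    of matching tensors is the Gram matrix of one family of integral vectors. [C] is its symmetric
    generalized inverse, the analogue of the Weingarten function. *)
Lemma weingarten m : exists2 C : 'S_m.*2 -> 'S_m.*2 -> k,
  forall x c, \sum_y \sum_z C y z * tdot (mtensor H z) (mtensor D x) * mtensor D y c
     = mtensor D x c &
  forall x c, \sum_y \sum_z C y z * tdot (mtensor H x) (mtensor D y) * mtensor H z c
     = mtensor H x c.
Proof.
have [P uP PHP] := symplectic_basis two_neq0 skH uH.
pose J := Jmx n k.
have [HE DE] := symplectic_metric uP PHP; rewrite -/J in HE DE.
pose u (x : 'S_m.*2) (c : mindex n.*2 m.*2) := mtensor (Jmx n int) x c.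
have [d d0 [Z symZ ZE]] := gram_pinv_int u.
have uE x c : mtensor J x c = (u x c)%:~R.
  rewrite rmorph_prod; apply: eq_bigr => i _ /=.
  by rewrite /J -(Jmx_map n (intr : {rmorphism int -> k})) mxE.
have mH (x : 'S_m.*2) : mtensor H x =1 tact (invmx P) (mtensor J x).
  by move=> c; rewrite tact_mtensor -HE.
have mD (x : 'S_m.*2) : mtensor D x =1 tact P^T (mtensor J x).
  by move=> c; rewrite tact_mtensor trmxK -DE.
(* The change of basis acts on the two sides by contragredient matrices and cancels. *)
have dotE (x z : 'S_m.*2) : tdot (mtensor H z) (mtensor D x) = (\sum_e u z e * u x e)%:~R.
  rewrite (eq_tdot (mH z) (mD x)) tdot_act.
  rewrite (eq_tdot (fun _ => erefl) (tactM _ _ _)) -trmx_mul mulmxV // trmx1.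
  rewrite (eq_tdot (fun _ => erefl) (tact1 _)) rmorph_sum.
  by apply: eq_bigr => e _; rewrite !uE rmorphM.
have d0k : d%:~R != 0 :> k.
  move: d0; case: d {ZE} => d /=; rewrite ?NegzE ?rmorphN ?oppr_eq0 /=.
    by rewrite -pmulrn ((pcharf0P k).1 char_k).
  by rewrite -pmulrn ((pcharf0P k).1 char_k).
pose C y z : k := (d%:~R)^-1 * (Z y z)%:~R.
have CJ x c : \sum_y \sum_z C y z * tdot (mtensor H z) (mtensor D x) * mtensor J y c
     = mtensor J x c.
  rewrite uE; apply: (mulfI d0k); rewrite -[RHS]rmorphM /= -ZE rmorph_sum mulr_sumr.
  apply: eq_bigr => y _; rewrite rmorph_sum mulr_sumr; apply: eq_bigr => z _ /=.
  by rewrite dotE uE /C !mulrA mulfV // mul1r !rmorphM.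
have dotC (x y : 'S_m.*2) : tdot (mtensor H x) (mtensor D y) = tdot (mtensor H y) (mtensor D x).
  by rewrite !dotE; congr (_%:~R); apply: eq_bigr => e _; rewrite mulrC.
have tact_sum A x c : \sum_y \sum_z C y z * tdot (mtensor H z) (mtensor D x) *
     tact A (mtensor J y) c = tact A (mtensor J x) c.
  rewrite [RHS](eq_tact _ (fun c => esym (CJ x c))) /tact.
  under [RHS]eq_bigr do rewrite mulr_sumr.
  rewrite [RHS]exchange_big; apply: eq_bigr => y _ /=.
  under [RHS]eq_bigr do rewrite mulr_sumr.
  rewrite [RHS]exchange_big; apply: eq_bigr => z _ /=.
  by rewrite mulr_sumr; apply: eq_bigr => e _; rewrite mulrCA.
exists C => x c.
  rewrite mD -tact_sum; apply: eq_bigr => y _; apply: eq_bigr => z _.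
  by rewrite mD.
rewrite mH -tact_sum exchange_big; apply: eq_bigr => z _; apply: eq_bigr => y _.
by rewrite mH dotC /C symZ.
Qed.

End Weingarten.

Definition mindex_perm N r (s : 'S_r) (c : mindex N r) : mindex N r :=
  [ffun j => c (s j)].

Lemma mindex_perm_inj N r (s : 'S_r) : injective (@mindex_perm N r s).
Proof.
move=> c d /ffunP cd; apply/ffunP => j.
by have := cd ((s^-1)%g j); rewrite !ffunE permKV.
Qed.

(** * The projector onto the invariants and its uniqueness *)

Section HaarTensor.

Variables (k : fieldType) (n : nat) (H : 'M[k]_(n.*2)).
Let D := dual_metric H.

(* For the invariant integral this is the integral of g (x) ... (x) g, i.e.   *)
(* the projector of E^(x)2m onto its invariants.                              *)
Definition haar_tensor m (t : tensor k n.*2 m.*2) : Prop :=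
  [/\ exists C : 'S_m.*2 -> 'S_m.*2 -> k, forall b a,
        t b a = \sum_y \sum_z C y z * mtensor H z b * mtensor D y a,
      forall x a, \sum_b t b a * mtensor D x b = mtensor D x a
    & forall x b, \sum_a t b a * mtensor H x a = mtensor H x b].

Lemma haar_tensor_exists m : [pchar k] =i pred0 -> H^T = - H -> H \in unitmx ->
  exists t : tensor k n.*2 m.*2, haar_tensor t.
Proof.
move=> char_k skH uH; have [C CD CH] := weingarten char_k skH uH m.
exists (fun b a => \sum_y \sum_z C y z * mtensor H z b * mtensor D y a).
split; first by exists C.
- move=> x a; rewrite -[RHS]CD; under eq_bigr do rewrite mulr_suml.
  rewrite exchange_big; apply: eq_bigr => y _ /=.
  under eq_bigr do rewrite mulr_suml.
  rewrite exchange_big; apply: eq_bigr => z _ /=.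
  rewrite mulrAC /tdot mulr_sumr; apply: eq_bigr => c _; rewrite mulrA.
  by congr (_ * _); rewrite mulrAC.
- move=> x b; rewrite -[RHS]CH; under eq_bigr do rewrite mulr_suml.
  rewrite exchange_big; apply: eq_bigr => y _ /=.
  under eq_bigr do rewrite mulr_suml.
  rewrite exchange_big; apply: eq_bigr => z _ /=.
  rewrite mulrAC /tdot mulr_sumr; apply: eq_bigr => c _.
  by rewrite -!mulrA [mtensor H x c * _]mulrC.
Qed.

Section Fixed.

Variables (m : nat) (t : tensor k n.*2 m.*2).
Hypothesis ht : haar_tensor t.

Lemma haar_tensor_fixD (I : finType) (e : I -> k) (x : I -> 'S_m.*2) v a :
    (forall c, v c = \sum_i e i * mtensor D (x i) c) ->
  \sum_b t b a * v b = v a.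
Proof.
case: ht => _ tD _ vE; rewrite vE; under eq_bigr do rewrite vE mulr_sumr.
rewrite exchange_big; apply: eq_bigr => i _ /=; rewrite -[in RHS]tD mulr_sumr.
by apply: eq_bigr => b _; rewrite mulrCA.
Qed.

Lemma haar_tensor_fixH (I : finType) (e : I -> k) (x : I -> 'S_m.*2) v b :
    (forall c, v c = \sum_i e i * mtensor H (x i) c) ->
  \sum_a t b a * v a = v b.
Proof.
case: ht => _ _ tH vE; rewrite vE; under eq_bigr do rewrite vE mulr_sumr.
rewrite exchange_big; apply: eq_bigr => i _ /=; rewrite -[in RHS]tH mulr_sumr.
by apply: eq_bigr => a _; rewrite mulrCA.
Qed.

Lemma haar_tensor_rowD b : exists e : 'S_m.*2 -> k,
  forall a, t b a = \sum_y e y * mtensor D y a.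
Proof.
case: ht => - [C tE] _ _; exists (fun y => \sum_z C y z * mtensor H z b) => a.
by rewrite tE; apply: eq_bigr => y _; rewrite mulr_suml.
Qed.

Lemma haar_tensor_colH a : exists e : 'S_m.*2 -> k,
  forall b, t b a = \sum_z e z * mtensor H z b.
Proof.
case: ht => - [C tE] _ _; exists (fun z => \sum_y C y z * mtensor D y a) => b.
rewrite tE exchange_big; apply: eq_bigr => z _; rewrite mulr_suml.
by apply: eq_bigr => y _; rewrite mulrAC.
Qed.

End Fixed.

(** The composite of the two projectors equals each of them: the rows of [t] are combinations of
    copies of [D], fixed by [t'], and the columns of [t'] are combinations of copies of [H], fixed
    by [t]. *)
Lemma haar_tensor_unique m (t t' : tensor k n.*2 m.*2) :
  haar_tensor t -> haar_tensor t' -> t =2 t'.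
Proof.
move=> ht ht' b a; transitivity (\sum_c t' c a * t b c).
  by have [e eE] := haar_tensor_rowD ht b; rewrite (haar_tensor_fixD ht' _ eE).
have [e eE] := haar_tensor_colH ht' a; rewrite -(haar_tensor_fixH ht _ eE).
by apply: eq_bigr => c _; rewrite mulrC.
Qed.

(** Permuting the positions permutes the matchings and so preserves the axioms; uniqueness
    concludes. *)
Lemma haar_tensor_sym m (t : tensor k n.*2 m.*2) (s : 'S_m.*2) b a :
  haar_tensor t -> t (mindex_perm s b) (mindex_perm s a) = t b a.
Proof.
move=> ht; apply: (haar_tensor_unique (t := fun b a => t (mindex_perm s b) (mindex_perm s a)))
  => // {b a}.
case: ht => - [C tE] tD tH.
have permK' (c : mindex n.*2 m.*2) : mindex_perm s^-1%g (mindex_perm s c) = c.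
  by apply/ffunP => j; rewrite !ffunE permKV.
have mtE G x (c : mindex n.*2 m.*2) : mtensor G x c = mtensor G (x * s^-1)%g (mindex_perm s c).
  by rewrite -{1}[c]permK' mtensor_perm.
split.
- exists (fun y z => C (y * s^-1)%g (z * s^-1)%g) => b a.
  rewrite tE (reindex_inj (mulIg (s^-1)%g)) /=; apply: eq_bigr => y _.
  rewrite (reindex_inj (mulIg (s^-1)%g)) /=; apply: eq_bigr => z _.
  by rewrite -!mtE.
- move=> x a; rewrite mtE -tD [RHS](reindex_inj (@mindex_perm_inj _ _ s)) /=.
  by apply: eq_bigr => b _; rewrite -mtE.
- move=> x b; rewrite mtE -tH [RHS](reindex_inj (@mindex_perm_inj _ _ s)) /=.
  by apply: eq_bigr => a _; rewrite -mtE.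
Qed.

End HaarTensor.

(** * Adding a pair of positions and contracting it *)

Section Extension.

Variables (N m : nat).
Implicit Types (a : mindex N m.*2) (p q : 'I_N).

(** Embeds the 2m positions as the first m of m + 1 pairs; the last pair, on which [epos_inv] is
    [None], is the one to be contracted. *)
Definition epos (j : 'I_m.*2) : 'I_m.+1.*2 :=
  if odd j then pos2 (lift ord_max (half_pos j))
  else pos1 (lift ord_max (half_pos j)).

Definition epos_inv (j : 'I_m.+1.*2) : option 'I_m.*2 :=
  omap (fun i => if odd j then pos2 i else pos1 i) (unlift ord_max (half_pos j)).

Lemma epos1 i : epos (pos1 i) = pos1 (lift ord_max i).
Proof. by rewrite /epos odd_pos1 half_pos1. Qed.

Lemma epos2 i : epos (pos2 i) = pos2 (lift ord_max i).
Proof. by rewrite /epos odd_pos2 half_pos2. Qed.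

Lemma eposK j : epos_inv (epos j) = Some j.
Proof.
case: (pos_cases j) => i [] ->; rewrite ?epos1 ?epos2 /epos_inv.
  by rewrite odd_pos1 half_pos1 liftK.
by rewrite odd_pos2 half_pos2 liftK.
Qed.

Lemma epos_inj : injective epos.
Proof. by move=> i j /(congr1 epos_inv); rewrite !eposK => - []. Qed.

Variant epos_spec : 'I_m.+1.*2 -> option 'I_m.*2 -> Type :=
  | EposSome j : epos_spec (epos j) (Some j)
  | EposFst : epos_spec (pos1 ord_max) None
  | EposSnd : epos_spec (pos2 ord_max) None.

Lemma eposP j : epos_spec j (epos_inv j).
Proof.
rewrite /epos_inv; case: unliftP => [i|] hj /=; rewrite {1}[j]posE hj.
  by case: (odd j); rewrite -?epos1 -?epos2; constructor.
by case: (odd j); constructor.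
Qed.

Lemma epos_neq1 j : epos j != pos1 ord_max.
Proof.
apply/eqP => /(congr1 epos_inv); rewrite eposK /epos_inv.
by rewrite half_pos1 unlift_none.
Qed.

Lemma epos_neq2 j : epos j != pos2 ord_max.
Proof.
apply/eqP => /(congr1 epos_inv); rewrite eposK /epos_inv.
by rewrite half_pos2 unlift_none.
Qed.

Definition ext a p q : mindex N m.+1.*2 :=
  [ffun j => if epos_inv j is Some j' then a j' else if odd j then q else p].

Lemma ext_epos a p q j : ext a p q (epos j) = a j.
Proof. by rewrite ffunE eposK. Qed.

Lemma ext_fst a p q : ext a p q (pos1 ord_max) = p.
Proof. by rewrite ffunE /epos_inv half_pos1 unlift_none odd_pos1. Qed.

Lemma ext_snd a p q : ext a p q (pos2 ord_max) = q.
Proof. by rewrite ffunE /epos_inv half_pos2 unlift_none odd_pos2. Qed.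

Lemma extK (c : mindex N m.+1.*2) :
  ext [ffun j => c (epos j)] (c (pos1 ord_max)) (c (pos2 ord_max)) = c.
Proof.
apply/ffunP => j; case: (eposP j) => [j'||];
  by rewrite ?(ext_epos, ext_fst, ext_snd) ?ffunE.
Qed.

Lemma sum_ext (V : nmodType) (F : mindex N m.+1.*2 -> V) :
  \sum_c F c = \sum_a \sum_p \sum_q F (ext a p q).
Proof.
under [RHS]eq_bigr do rewrite pair_bigA /=.
rewrite pair_bigA /= (reindex (fun u : mindex N m.*2 * ('I_N * 'I_N) =>
  ext u.1 u.2.1 u.2.2)) //.
exists (fun c : mindex N m.+1.*2 => ([ffun j => c (epos j)] : mindex N m.*2,
                  (c (pos1 ord_max), c (pos2 ord_max)))) => [[a [p q]] _|c _] /=.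
  by rewrite ext_fst ext_snd; congr (_, _); apply/ffunP => j; rewrite ffunE ext_epos.
exact: extK.
Qed.

Lemma big_lift (R : comNzRingType) (F : 'I_m.+1 -> R) :
  \prod_i F i = (\prod_(i < m) F (lift ord_max i)) * F ord_max.
Proof.
rewrite big_ord_recr /=; congr (_ * _); apply: eq_bigr => i _; congr F.
by apply: val_inj; rewrite /= /bump leqNgt ltn_ord.
Qed.

Lemma prod_ext (R : comNzRingType) (F : 'I_m.+1.*2 -> R) :
  \prod_j F j = (\prod_(j < m.*2) F (epos j)) * (F (pos1 ord_max) * F (pos2 ord_max)).
Proof.
rewrite !(prod_pos 1) big_lift; congr (_ * _); last by rewrite !perm1.
by apply: eq_bigr => i _; rewrite !perm1 epos1 epos2.
Qed.

Lemma perm_restrict (x : 'S_m.+1.*2) :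
    x (pos1 ord_max) = pos1 ord_max -> x (pos2 ord_max) = pos2 ord_max ->
  exists y : 'S_m.*2, forall j, x (epos j) = epos (y j).
Proof.
move=> x1 x2; have /fin_all_exists[f fE] j : exists j', x (epos j) = epos j'.
  move Ez: (x (epos j)) => z; case: (eposP z) Ez => [j'||/eqP]; first by exists j'.
    by rewrite -[RHS]x1 => /perm_inj/eqP; rewrite (negbTE (epos_neq1 j)).
  by rewrite -[X in _ == X]x2 (inj_eq perm_inj) (negbTE (epos_neq2 j)).
have f_inj : injective f.
  by move=> i j fij; apply: epos_inj; apply: (@perm_inj _ x); rewrite !fE fij.
by exists (perm f_inj) => j; rewrite permE.
Qed.

Lemma perm_extend (y : 'S_m.*2) : exists x : 'S_m.+1.*2,
  [/\ x (pos1 ord_max) = pos1 ord_max, x (pos2 ord_max) = pos2 ord_max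
    & forall j, x (epos j) = epos (y j)].
Proof.
pose f (z : 'S_m.*2) j := if epos_inv j is Some j' then epos (z j') else j.
have fK z : cancel (f z) (f z^-1%g).
  move=> j; case: (eposP j) => [j'||]; rewrite /f.
  - by rewrite !eposK permK.
  - by rewrite /epos_inv half_pos1 unlift_none /= half_pos1 unlift_none.
  - by rewrite /epos_inv half_pos2 unlift_none /= half_pos2 unlift_none.
exists (perm (can_inj (fK y))); split => [||j]; rewrite permE /f.
- by rewrite /epos_inv half_pos1 unlift_none.
- by rewrite /epos_inv half_pos2 unlift_none.
- by rewrite eposK.
Qed.

Lemma mtensor_ext (R : comNzRingType) (G : 'M[R]_N) (x : 'S_m.+1.*2) (y : 'S_m.*2) a p q :
    x (pos1 ord_max) = pos1 ord_max -> x (pos2 ord_max) = pos2 ord_max ->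
    (forall j, x (epos j) = epos (y j)) ->
  mtensor G x (ext a p q) = mtensor G y a * G p q.
Proof.
move=> x1 x2 xy; rewrite /mtensor big_lift x1 x2 ext_fst ext_snd; congr (_ * _).
by apply: eq_bigr => i _; rewrite -epos1 -epos2 !xy !ext_epos.
Qed.

End Extension.

Section Contraction.

Variables (k : fieldType) (n : nat) (H : 'M[k]_(n.*2)).
Hypotheses (skH : H^T = - H) (uH : H \in unitmx).
Let D := dual_metric H.

Let skD : D^T = - D. Proof. exact: dual_skew. Qed.

Definition contract m (x : 'S_m.+1.*2) (a : mindex n.*2 m.*2) : k :=
  \sum_p \sum_q H p q * mtensor D x (ext a p q).

(** If the two contracted positions are matched to each other, the contraction splits off a scalar;
    otherwise their partners become matched. Renumbering the copies and swapping the two indices of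
    a copy brings [x] to one of these two forms, up to sign. *)
Lemma contract_mtensor m (x : 'S_m.+1.*2) :
  exists y e, forall a, contract x a = e * mtensor D y a.
Proof.
pose Q (z : 'S_m.+1.*2) := exists y e, forall a, contract z a = e * mtensor D y a.
have flip (z : 'S_m.+1.*2) i : Q (tperm (pos1 i) (pos2 i) * z)%g -> Q z.
  case=> y [e eE]; exists y, (- e) => a; rewrite mulNr -eE /contract -sumrN.
  apply: eq_bigr => p _; rewrite -sumrN; apply: eq_bigr => q _.
  by rewrite mtensor_flip // mulrN opprK.
have pairs (z : 'S_m.+1.*2) s : Q (bipos s s * z)%g -> Q z.
  case=> y [e eE]; exists y, e => a; rewrite -eE.
  by apply: eq_bigr => p _; apply: eq_bigr => q _; rewrite mtensor_bipos.
rewrite -/(Q x).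
wlog x1 : x / x (pos1 ord_max) = pos1 ord_max => [IH|].
  wlog [i xi] : x / exists i, x (pos1 i) = pos1 ord_max => [IH2|].
    have [i [xi|xi]] := pos_cases ((x^-1)%g (pos1 ord_max)).
      by apply: IH2; exists i; rewrite -xi permKV.
    by apply: (flip _ i); apply: IH2; exists i; rewrite permM tpermL -xi permKV.
  apply: (pairs _ (tperm i ord_max)); apply: IH.
  by rewrite permM bipos1 tpermR.
have [i xi] : exists i, x (pos1 i) = pos2 ord_max \/ x (pos2 i) = pos2 ord_max.
  have [i [xi|xi]] := pos_cases ((x^-1)%g (pos2 ord_max)); exists i.
    by left; rewrite -xi permKV.
  by right; rewrite -xi permKV.
(* The second contracted position lies in the last copy, which yields a scalar, or in another copy
   [i]. *)
have [im|im] := eqVneq i ord_max.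
  rewrite im in xi; case: xi => [|x2].
    by rewrite x1 => /eqP; rewrite (negbTE (pos12_neq _ _)).
  have [y xy] := perm_restrict x1 x2.
  exists y, (\sum_p \sum_q H p q * D p q) => a; rewrite mulr_suml.
  apply: eq_bigr => p _; rewrite mulr_suml; apply: eq_bigr => q _.
  by rewrite (mtensor_ext _ _ _ _ x1 x2 xy) -mulrA [D p q * _]mulrC.
wlog xi1 : x x1 xi / x (pos1 i) = pos2 ord_max => [IH|].
  case: xi => xi; first by apply: IH; [|left|].
  apply: (flip _ i); apply: IH; first 1 last.
  - by left; rewrite permM tpermL.
  - by rewrite permM tpermL.
  rewrite permM tpermD ?pos21_neq // (inj_eq (@pos1_inj _)) //.
(* After this exchange the last copy occupies the contracted positions, and copy [i] joins their two
   former partners. *)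
pose z := (tperm (pos2 ord_max) (pos1 i) * x)%g.
have z1 : z (pos1 ord_max) = pos1 ord_max.
  by rewrite permM tpermD ?pos21_neq // (inj_eq (@pos1_inj _)).
have z2 : z (pos2 ord_max) = pos2 ord_max by rewrite permM tpermL.
have [y zy] := perm_restrict z1 z2; exists y, 1 => a; rewrite mul1r.
have [i0 iE|iE] := unliftP ord_max i; last by rewrite iE eqxx in im.
have yE1 : epos (y (pos1 i0)) = x (pos2 ord_max).
  by rewrite -zy epos1 -iE permM tpermR.
have yE2 : epos (y (pos2 i0)) = x (pos2 i).
  rewrite -zy epos2 -iE permM tpermD ?pos12_neq // (inj_eq (@pos2_inj _)).
  by rewrite eq_sym.
rewrite {1}/mtensor (bigD1 i0) //=.
set rest := \prod_(_ | _) _; set A := a (y (pos1 i0)); set B := a (y (pos2 i0)).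
have xE p q : mtensor D x (ext a p q) = D p A * D q B * rest.
  rewrite /mtensor big_lift x1 (bigD1 i0) //= -iE xi1 ext_fst ext_snd.
  rewrite -yE1 -yE2 !ext_epos mulrC mulrA; congr (_ * _).
  apply: eq_bigr => l li; have zx j : j != i0 -> z (pos1 (lift ord_max j)) = x (pos1 (lift ord_max j)).
    move=> ji; rewrite permM tpermD ?pos21_neq // iE (inj_eq (@pos1_inj _)).
    by rewrite (inj_eq lift_inj) eq_sym.
  have zx2 j : z (pos2 (lift ord_max j)) = x (pos2 (lift ord_max j)).
    by rewrite permM tpermD ?pos12_neq // (inj_eq (@pos2_inj _)) neq_lift.
  by rewrite -zx // -zx2 -epos1 -epos2 !zy !ext_epos.
rewrite /contract exchange_big /=.
transitivity (\sum_q (q == A)%:R * D q B * rest).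
  apply: eq_bigr => q _; rewrite -(dual_metricE _ _ uH) !mulr_suml.
  by apply: eq_bigr => p _; rewrite xE !mulrA.
rewrite (bigD1 A) //= eqxx mul1r big1 ?addr0 // => q /negbTE ->.
by rewrite !mul0r.
Qed.

(** A contracted row of [t'] is a combination of copies of [D] in degree 2m, so inserting [t] does
    not change it; then [t'] meets a column of [t] times [H], which it fixes in turn. This identity
    is what makes the integral vanish on the generators of the ideal. *)
Lemma haar_tensor_contract m (t : tensor k n.*2 m.*2) (t' : tensor k n.*2 m.+1.*2) :
  haar_tensor H t -> haar_tensor H t' -> forall b a p q,
  \sum_c \sum_d H c d * t' (ext b p q) (ext a c d) = H p q * t b a.
Proof.
move=> ht ht' b a p q; pose K (c : mindex n.*2 m.*2) :=
  \sum_u \sum_v H u v * t' (ext b p q) (ext c u v).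
have [e eE] := haar_tensor_rowD ht' (ext b p q).
have [y yE] : exists y : 'S_m.+1.*2 -> 'S_m.*2, exists f, forall x c,
    contract x c = f x * mtensor D (y x) c.
  have /fin_all_exists[y /fin_all_exists[f fE]] := @contract_mtensor m.
  by exists y, f.
case: yE => f fE.
have KE c : K c = \sum_x (e x * f x) * mtensor D (y x) c.
  rewrite /K; under eq_bigr do under eq_bigr do rewrite eE mulr_sumr.
  under eq_bigr do rewrite exchange_big.
  rewrite exchange_big; apply: eq_bigr => x _ /=; rewrite -mulrA -fE mulr_sumr.
  apply: eq_bigr => u _; rewrite mulr_sumr; apply: eq_bigr => v _.
  by rewrite mulrCA.
rewrite -[LHS]/(K a) -(haar_tensor_fixD ht a KE).
have [g gE] := haar_tensor_colH ht a.
have [z zE] : exists z : 'S_m.*2 -> 'S_m.+1.*2, forall x c u v,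
    mtensor H (z x) (ext c u v) = mtensor H x c * H u v.
  have /fin_all_exists[z zE] := @perm_extend m.
  by exists z => x c u v; have [z1 z2 zx] := zE x; apply: mtensor_ext.
(* A column of [t] with one more copy of [H] on the last pair. *)
pose L (c : mindex n.*2 m.+1.*2) := H (c (pos1 ord_max)) (c (pos2 ord_max)) *
  t [ffun j => c (epos j)] a.
have LE c : L c = \sum_x g x * mtensor H (z x) c.
  rewrite -[in RHS](extK c) /L gE mulr_sumr.
  by apply: eq_bigr => x _; rewrite zE mulrCA [H _ _ * _]mulrC.
have Lext c u v : L (ext c u v) = H u v * t c a.
  by rewrite /L ext_fst ext_snd; congr (_ * t _ _); apply/ffunP => j; rewrite ffunE ext_epos.
rewrite -Lext -(haar_tensor_fixH ht' _ LE) sum_ext.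
apply: eq_bigr => c _; rewrite mulr_sumr; apply: eq_bigr => u _.
rewrite mulr_sumr; apply: eq_bigr => v _; rewrite Lext.
by rewrite mulrA mulrC [t c a * _]mulrC.
Qed.

End Contraction.

(** * The invariant integral as a contraction *)

Section ScalarForms.

Variables (k : fieldType) (d : nat).
Implicit Types w : {mpoly k[d]} -> k.

Lemma scalar_formD w : scalar w -> {morph w : p q / p + q}.
Proof. by move=> lw p q; rewrite -[p]scale1r lw mul1r scale1r. Qed.

Lemma scalar_form0 w : scalar w -> w 0 = 0.
Proof. by move=> lw; apply: (addIr (w 0)); rewrite -scalar_formD // addr0 add0r. Qed.

Lemma scalar_formZ w c p : scalar w -> w (c *: p) = c * w p.
Proof. by move=> lw; rewrite -[c *: p]addr0 lw scalar_form0 // addr0. Qed.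

Lemma scalar_form_sum w I (r : seq I) (P : pred I) F : scalar w ->
  w (\sum_(i <- r | P i) F i) = \sum_(i <- r | P i) w (F i).
Proof.
move=> lw; apply: (big_morph w (scalar_formD lw) (scalar_form0 lw)).
Qed.

Lemma scalar_formE w p : scalar w ->
  w p = \sum_(u <- msupp p) p@_u * w 'X_[u].
Proof.
move=> lw; rewrite {1}[p]mpolyE scalar_form_sum //.
by apply: eq_bigr => u _; rewrite scalar_formZ.
Qed.

Lemma eq_scalar_form w w' : scalar w -> scalar w' ->
  (forall u, w 'X_[u] = w' 'X_[u]) -> w =1 w'.
Proof.
move=> lw lw' eww p; rewrite (scalar_formE p lw) (scalar_formE p lw').
by apply: eq_bigr => u _; rewrite eww.
Qed.

End ScalarForms.

Section TensorForms.

Variables (k : fieldType) (N r : nat).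

Definition tsym (t : tensor k N r) :=
  forall (s : 'S_r) b a, t (mindex_perm s b) (mindex_perm s a) = t b a.

Lemma mxvec_index_inj m l (ij ij' : 'I_m * 'I_l) :
  mxvec_index ij.1 ij.2 = mxvec_index ij'.1 ij'.2 -> ij = ij'.
Proof.
by case: ij ij' => [i j] [i' j'] /= /cast_ord_inj /enum_rank_inj [-> ->].
Qed.

Lemma mono_eqP (b a b' a' : mindex N r) :
  reflect (exists s : 'S_r, b = mindex_perm s b' /\ a = mindex_perm s a')
          (mono b a == mono b' a').
Proof.
pose T b a := [tuple mxvec_index ((a : mindex N r) j) ((b : mindex N r) j) | j < r].
have TE b0 a0 l : count_mem l (T b0 a0) = mono b0 a0 l.
  rewrite mnm_sumE -sum1_count big_map big_mkcond /= enumT.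
  apply: eq_bigr => j _; rewrite mnm1E; by case: eqP.
apply: (iffP eqP) => [E|[s [-> ->]]]; last first.
  rewrite /mono [RHS](reindex_inj (@perm_inj _ s)) /=.
  by apply: eq_bigr => j _; rewrite !ffunE.
have /tuple_permP[s sE] : perm_eq (T b a) (T b' a').
  by apply/allP => l _ /=; rewrite !TE E.
exists s; suff ba j : (b j, a j) = (b' (s j), a' (s j)).
  by split; apply/ffunP => j; have [e1 e2] := ba j; rewrite ffunE.
have: tnth (T b a) j = tnth (T b' a') (s j).
  by rewrite (tnth_nth (tnth (T b a) j)) sE -tnth_nth tnth_mktuple.
by rewrite !tnth_mktuple => /(@mxvec_index_inj _ _ (_, _) (_, _)) [-> ->].
Qed.

Lemma tensor_form_scalar (t : tensor k N r) : scalar (tensor_form t).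
Proof.
move=> c p q; rewrite /tensor_form mulr_sumr -big_split; apply: eq_bigr => b _.
rewrite mulr_sumr -big_split; apply: eq_bigr => a _ /=.
by rewrite mcoeffD mcoeffZ mulrDl mulrDr; congr (_ + _); rewrite -mulrA mulrCA.
Qed.

Lemma tensor_form_deg (t : tensor k N r) u : mdeg u != r -> tensor_form t 'X_[u] = 0.
Proof.
move=> du; rewrite /tensor_form big1 // => b _; rewrite big1 // => a _.
rewrite mcoeffX; case: eqP => [uE|]; last by rewrite mul0r mulr0.
by rewrite uE mdeg_mono eqxx in du.
Qed.

Lemma tensor_form_mono (t : tensor k N r) b a : [pchar k] =i pred0 -> tsym t ->
  tensor_form t 'X_[mono b a] = t b a.
Proof.
move=> /pcharf0P char0 symt; rewrite /tensor_form pair_bigA /=.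
pose S := [set c : mindex N r * mindex N r | mono c.1 c.2 == mono b a].
rewrite (bigID (fun c => c \in S)) /= [X in _ + X]big1 => [|c]; last first.
  by rewrite inE mcoeffX eq_sym => /negbTE->; rewrite mul0r mulr0.
rewrite addr0 (eq_bigr (fun=> t b a / #|S|%:R)) => [|c]; last first.
  rewrite inE => /eqP cE; rewrite cE mcoeffX eqxx mul1r.
  by move/eqP/mono_eqP: cE => [s [-> ->]]; rewrite symt.
rewrite sumr_const -[LHS]mulr_natr divfK // char0 -lt0n.
by apply/card_gt0P; exists (b, a); rewrite inE.
Qed.

Lemma symmetrize_sym (t : tensor k N r) : tsym (symmetrize t).
Proof.
move=> s b a; rewrite /symmetrize; congr (_ * _).
rewrite [RHS](reindex_inj (mulIg s)) /=; apply: eq_bigr => x _.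
by congr t; apply/ffunP => j; rewrite !ffunE permM.
Qed.

End TensorForms.

Lemma mpolyX_mono (R : comNzRingType) N r (b a : mindex N r) :
  'X_[R, mono b a] = \prod_(j < r) 'X_(mxvec_index (a j) (b j)).
Proof. by rewrite /mono -mprodXE. Qed.

Lemma mono_ext (R : comNzRingType) N m (b a : mindex N m.*2) i j c d :
  'X_[R, mono (ext b i j) (ext a c d)] =
  'X_[mono b a] * ('X_(mxvec_index c i) * 'X_(mxvec_index d j)).
Proof.
rewrite !mpolyX_mono prod_ext !ext_fst !ext_snd; congr (_ * _).
by apply: eq_bigr => l _; rewrite !ext_epos.
Qed.

Lemma mono_even N (u : 'X_{1..N * N}) : ~~ odd (mdeg u) ->
  exists m, exists b a : mindex N m.*2, u = mono b a.
Proof.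
move=> /negbTE ou; have := odd_double_half (mdeg u); rewrite ou add0n => du.
by have [[b a] <-] := mono_surj (esym du); exists (mdeg u)./2, b, a.
Qed.

Lemma monoP N (u : 'X_{1..N * N}) :
  exists r, exists b a : mindex N r, u = mono b a.
Proof. by have [[b a] <-] := mono_surj (erefl (mdeg u)); exists (mdeg u), b, a. Qed.

Section HaarForm.

Variables (k : fieldType) (n : nat) (H : 'M[k]_(n.*2)).
Hypotheses (char_k : [pchar k] =i pred0) (skH : H^T = - H) (uH : H \in unitmx).
Variable t : forall m, tensor k n.*2 m.*2.
Hypothesis ht : forall m, haar_tensor H (@t m).

(** The tensor [t m] acts in degree 2m, so the terms with [m >= msize p] would vanish
    ([haar_form_bound]). *)
Definition haar_form (p : {mpoly k[n.*2 * n.*2]}) : k :=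
  \sum_(m < msize p) tensor_form (@t m) p.

Lemma haar_form_bound M p : (msize p <= M)%N ->
  haar_form p = \sum_(m < M) tensor_form (@t m) p.
Proof.
move=> pM; rewrite /haar_form.
rewrite (big_ord_widen M (fun m => tensor_form (@t m) p) pM) big_mkcond /=.
apply: eq_bigr => m _; case: ltnP => // pm.
rewrite (scalar_formE _ (@tensor_form_scalar _ _ _ _)) big_seq big1 // => u up.
rewrite tensor_form_deg ?mulr0 // neq_ltn (leq_trans (msize_mdeg_lt up)) //.
by rewrite (leq_trans pm) // -addnn leq_addr.
Qed.

Lemma haar_form_scalar : scalar haar_form.
Proof.
move=> c p q; set M := maxn (msize (c *: p + q)) (maxn (msize p) (msize q)).
rewrite !(@haar_form_bound M) ?leq_max ?leqnn ?orbT //.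
rewrite mulr_sumr -big_split; apply: eq_bigr => m _ /=.
exact: tensor_form_scalar.
Qed.

Lemma haar_form_mono m (b a : mindex n.*2 m.*2) : haar_form 'X_[mono b a] = t b a.
Proof.
have st : tsym (@t m) by move=> s b' a'; apply: haar_tensor_sym.
rewrite -(tensor_form_mono b a char_k st).
have mM : (m < (msize 'X_[k, mono b a]))%N.
  by rewrite msizeX mdeg_mono ltnS -addnn leq_addr.
rewrite /haar_form (bigD1 (Ordinal mM)) //= big1 ?addr0 // => l lm.
rewrite tensor_form_deg // mdeg_mono (inj_eq double_inj) eq_sym.
by apply: contra lm => /eqP lm; apply/eqP/val_inj.
Qed.

Lemma haar_form_odd u : odd (mdeg u) -> haar_form 'X_[u] = 0.
Proof.
move=> ou; rewrite /haar_form big1 // => l _; rewrite tensor_form_deg //.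
by apply: contraTneq ou => ->; rewrite odd_double.
Qed.

(** It suffices to treat monomial multiples of the generators: in even degree this is
    [haar_tensor_contract], and in odd degree every term vanishes. *)
Lemma haar_form_ideal p : Sp_ideal H p -> haar_form p = 0.
Proof.
have hS I (r : seq I) P F := @scalar_form_sum _ _ _ I r P F haar_form_scalar.
have hZ c q := scalar_formZ c q haar_form_scalar.
case=> Q ->; rewrite hS big1 // => i _; rewrite hS big1 // => j _.
set HA := map_mx _ H; set X := genX n.*2 k.
have entryE : (X^T *m HA *m X - HA) i j =
    \sum_c \sum_d H c d *: ('X_(mxvec_index c i) * 'X_(mxvec_index d j)) - (H i j)%:MP.
  rewrite 2!mxE [(- HA) i j]mxE [HA i j]mxE; congr (_ - _).
  rewrite exchange_big; apply: eq_bigr => d _; rewrite mxE mulr_suml.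
  by apply: eq_bigr => c _; rewrite !mxE mulrAC mulrC mul_mpolyC.
rewrite entryE [Q i j]mpolyE mulr_suml hS big1 // => u _.
rewrite -scalerAl hZ [X in _ * X](_ : _ = 0) ?mulr0 //.
rewrite mulrBr [_ * _%:MP]mulrC mul_mpolyC.
rewrite addrC -scaleNr haar_form_scalar [X in _ + haar_form X]mulr_sumr hS.
under eq_bigr => c _.
  rewrite mulr_sumr hS; under eq_bigr => d _ do rewrite -scalerAr hZ.
  over.
have [ou|eu] := boolP (odd (mdeg u)).
  rewrite haar_form_odd // mulr0 add0r big1 // => c _; rewrite big1 // => d _.
  by rewrite -!mpolyXD haar_form_odd ?mulr0 // !mdegD !mdeg1 !oddD ou.
have [m [b [a ->]]] := mono_even eu.
rewrite haar_form_mono mulNr addrC.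
under eq_bigr do under eq_bigr do rewrite -mono_ext haar_form_mono.
by rewrite (haar_tensor_contract skH uH (ht m) (ht m.+1)) subrr.
Qed.

Lemma haar_form1 : haar_form 1 = 1.
Proof.
pose b : mindex n.*2 (0%N).*2 := ffun0 (card_ord 0).
have -> : 1 = 'X_[mono b b] :> {mpoly k[n.*2 * n.*2]}.
  by rewrite mpolyX_mono big_ord0.
have all_b (a : mindex n.*2 (0%N).*2) : a = b by apply/ffunP => - [].
rewrite haar_form_mono; have [_ _ /(_ 1%g b)] := ht 0.
rewrite /mtensor !big_ord0 (big_pred1 b) => [|a].
  by rewrite big_ord0 mulr1.
by rewrite [a]all_b /= eqxx.
Qed.

End HaarForm.

(** * Uniqueness *)

Section IdealAlgebra.

Variables (k : fieldType) (A : comAlgType k) (I : idealr A).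

Definition ideal_alg := {ideal_quot I}.
HB.instance Definition _ := GRing.ComNzRing.on ideal_alg.

Definition ideal_pi (p : A) : ideal_alg := \pi_(Quotient.quot I)%qT p.

Lemma ideal_pi_zmod_morphism : zmod_morphism ideal_pi.
Proof. exact: pi_is_zmod_morphism. Qed.
HB.instance Definition _ :=
  GRing.isZmodMorphism.Build A ideal_alg ideal_pi ideal_pi_zmod_morphism.

Lemma ideal_pi_monoid_morphism : monoid_morphism ideal_pi.
Proof. exact: pi_is_monoid_morphism. Qed.
HB.instance Definition _ :=
  GRing.isMonoidMorphism.Build A ideal_alg ideal_pi ideal_pi_monoid_morphism.

Definition ideal_scale (c : k) (x : ideal_alg) : ideal_alg := ideal_pi c%:A * x.

Lemma ideal_scaleA a b v :
  ideal_scale a (ideal_scale b v) = ideal_scale (a * b) v.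
Proof. by rewrite /ideal_scale mulrA -rmorphM /= -scalerAl mul1r scalerA. Qed.

Lemma ideal_scale1 : left_id 1 ideal_scale.
Proof. by move=> v; rewrite /ideal_scale scale1r rmorph1 mul1r. Qed.

Lemma ideal_scaleDr : right_distributive ideal_scale +%R.
Proof. by move=> a u v; rewrite /ideal_scale mulrDr. Qed.

Lemma ideal_scaleDl v : {morph ideal_scale^~ v : a b / a + b}.
Proof. by move=> a b; rewrite /ideal_scale scalerDl rmorphD mulrDl. Qed.

HB.instance Definition _ := GRing.Zmodule_isLmodule.Build k ideal_alg
  ideal_scaleA ideal_scale1 ideal_scaleDr ideal_scaleDl.

Lemma ideal_scaleAl (a : k) (u v : ideal_alg) : a *: (u * v) = (a *: u) * v.
Proof. by rewrite /GRing.scale /= /ideal_scale mulrA. Qed.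

HB.instance Definition _ :=
  GRing.Lmodule_isLalgebra.Build k ideal_alg ideal_scaleAl.
HB.instance Definition _ := GRing.Lalgebra_isComAlgebra.Build k ideal_alg.

Lemma ideal_piZ (c : k) p : ideal_pi (c *: p) = c *: ideal_pi p.
Proof. by rewrite [RHS]/GRing.scale /= /ideal_scale -rmorphM /= -scalerAl mul1r. Qed.

Lemma ideal_pi_eq0 p : (ideal_pi p == 0) = (p \in I).
Proof. by rewrite -[0](rmorph0 ideal_pi) -Quotient.idealrBE subr0. Qed.

End IdealAlgebra.

(** For the ideal of the group, the quotient is the algebra over which the generic point lives.
    Membership is made boolean by classical reflection. *)
Lemma quotient_algebra (k : fieldType) (A : comAlgType k) (I : A -> Prop) :
    I 0 -> ~ I 1 -> (forall a u v, I u -> I v -> I (a * u + v)) ->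
  exists (B : comAlgType k) (f : {rmorphism A -> B}),
    (forall c p, f (c *: p) = c *: f p) /\ (forall p, f p = 0 <-> I p).
Proof.
move=> I0 I1 ID; pose S : {pred A} := fun p => `[< I p >].
have SP p : reflect (I p) (p \in S) by apply: asboolP.
have cS : idealr_closed S.
  split; [exact/SP | exact/SP|].
  by move=> a u v /SP Iu /SP Iv; apply/SP/ID.
pose sS := isIdealr.Build A S cS.
pose J : idealr A := HB.pack S sS.
exists (ideal_alg J), (@ideal_pi _ _ J); split; first exact: ideal_piZ.
move=> p; split=> [/eqP|/SP pI]; first by rewrite ideal_pi_eq0 => /SP.
by apply/eqP; rewrite ideal_pi_eq0.
Qed.

(** * Extension of scalars and translation of monomials *)

Section ScalarExtension.

Variables (k : fieldType) (N : nat) (B : comAlgType k).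
Variable (w : {mpoly k[N * N]} -> k).
Implicit Types q : {mpoly B[N * N]}.

Lemma scalar_extE d q : (msize q <= d)%N ->
  scalar_ext w q = \sum_(u : 'X_{1..(N * N) < d}) w 'X_[u] *: q@_u.
Proof.
move=> qd; pose I : subFinType _ := 'X_{1..(N * N) < d}.
rewrite /scalar_ext (big_mksub I) ?msupp_uniq //=; last first.
  by move=> x /msize_mdeg_lt /leq_trans; apply.
by rewrite big_rmcond //= => i; move/memN_msupp_eq0 ->; rewrite scaler0.
Qed.

Lemma scalar_extD : {morph @scalar_ext k N B w : p q / p + q}.
Proof.
move=> p q; set d := maxn (msize (p + q)) (maxn (msize p) (msize q)).
rewrite !(@scalar_extE d) ?leq_max ?leqnn ?orbT // -big_split.
by apply: eq_bigr => u _; rewrite mcoeffD scalerDr.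
Qed.

Lemma scalar_extZ c q : scalar_ext w (c *: q) = c * scalar_ext w q.
Proof.
set d := maxn (msize (c *: q)) (msize q).
rewrite !(@scalar_extE d) ?leq_max ?leqnn ?orbT // mulr_sumr.
by apply: eq_bigr => u _; rewrite mcoeffZ scalerAr.
Qed.

Lemma scalar_ext_sum I (r : seq I) (P : pred I) (F : I -> {mpoly B[N * N]}) :
  scalar_ext w (\sum_(i <- r | P i) F i) = \sum_(i <- r | P i) scalar_ext w (F i).
Proof.
apply: (big_morph _ scalar_extD); rewrite /scalar_ext.
by rewrite msupp0 big_nil.
Qed.

Lemma scalar_extX u : @scalar_ext k N B w 'X_[u] = (w 'X_[u])%:A.
Proof. by rewrite /scalar_ext msuppX big_seq1 mcoeffX eqxx. Qed.

Lemma translate_mono (g : 'M[B]_N) r (b a : mindex N r) :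
  translate g 'X_[mono b a] =
  \sum_(c : mindex N r) (\prod_j g (a j) (c j)) *: 'X_[mono b c].
Proof.
pose f : {rmorphism k -> {mpoly B[N * N]}} := @mpolyC (N * N) B \o in_alg B.
rewrite /translate -[LHS]/(mmap f _ _) mpolyX_mono rmorph_prod /=.
under eq_bigr => j _.
  rewrite mmapX mmap1U mxvecE mxE.
  under eq_bigr => i _ do rewrite !mxE mul_mpolyC.
  over.
rewrite bigA_distr_bigA /=; apply: eq_bigr => c _.
by rewrite mpolyX_mono scaler_prod.
Qed.

Lemma translateE (g : 'M[B]_N) (p : {mpoly k[N * N]}) :
  translate g p = \sum_(u <- msupp p) (p@_u)%:A *: translate g 'X_[u].
Proof.
pose f : {rmorphism k -> {mpoly B[N * N]}} := @mpolyC (N * N) B \o in_alg B.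
rewrite /translate -[LHS]/(mmap f _ _) {1}[p]mpolyE raddf_sum /=.
by apply: eq_bigr => u _; rewrite mmapZ -[mmap _ _ 'X_[u]]/(mmap f _ _) mul_mpolyC.
Qed.

Lemma scalar_ext_translate (g : 'M[B]_N) r (b a : mindex N r) :
  scalar_ext w (translate g 'X_[mono b a]) =
  \sum_(c : mindex N r) (\prod_j g (a j) (c j)) * (w 'X_[mono b c])%:A.
Proof.
rewrite translate_mono scalar_ext_sum.
by apply: eq_bigr => c _; rewrite scalar_extZ scalar_extX.
Qed.

End ScalarExtension.

Section SymplecticPoints.

Variables (k : fieldType) (n : nat) (H : 'M[k]_(n.*2)).
Hypothesis uH : H \in unitmx.

(** The equation of the group exhibits a right inverse of [g] built from [g^T]; solving for the
    inverse of [H] gives the invariance of the dual metric. *)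
Lemma Sp_point_dual (B : comAlgType k) (g : 'M[B]_(n.*2)) : Sp_point H g ->
  let DB := map_mx (in_alg B) (dual_metric H) in g *m DB *m g^T = DB.
Proof.
rewrite /Sp_point /=; set HB := map_mx (in_alg B) H => gH.
pose HI := map_mx (in_alg B) (invmx H).
have HIV : HI *m HB = 1%:M by rewrite -map_mxM mulVmx // map_mx1.
have HIV' : HB *m HI = 1%:M by rewrite -map_mxM mulmxV // map_mx1.
have gHI : g *m (HI *m g^T *m HB) = 1%:M.
  by apply: mulmx1C; rewrite -!mulmxA (mulmxA g^T) gH.
have gHIg : g *m (HI *m g^T) = HI.
  by rewrite -[LHS]mulmx1 -HIV' mulmxA -(mulmxA g) gHI mul1mx.
by rewrite /dual_metric -map_trmx -/HI -{2}gHIg !trmx_mul trmxK.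
Qed.

Lemma Sp_ideal0 : Sp_ideal H 0.
Proof. by exists 0; rewrite big1 // => i _; rewrite big1 // => j _; rewrite mxE mul0r. Qed.

Lemma Sp_idealMD a u v : Sp_ideal H u -> Sp_ideal H v -> Sp_ideal H (a * u + v).
Proof.
case=> Q -> [R ->]; exists (a *: Q + R).
rewrite mulr_sumr -big_split; apply: eq_bigr => i _ /=.
rewrite mulr_sumr -big_split; apply: eq_bigr => j _ /=.
by rewrite [(a *: Q + R) i j]mxE [(a *: Q) i j]mxE mulrDl mulrA.
Qed.

Lemma Sp_ideal_gen i j :
  let HA := map_mx (@mpolyC (n.*2 * n.*2) k) H in
  Sp_ideal H (((genX n.*2 k)^T *m HA *m genX n.*2 k - HA) i j).
Proof.
move=> HA; set E := (X in X i j); exists (delta_mx i j).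
rewrite (bigD1 i) //= (bigD1 j) //= [delta_mx i j i j]mxE !eqxx mul1r -/HA -/E.
rewrite big1 => [|j' /negbTE jj]; last by rewrite mxE jj andbF mul0r.
rewrite addr0 big1 ?addr0 // => i' /negbTE ii.
by rewrite big1 // => j' _; rewrite mxE ii mul0r.
Qed.

End SymplecticPoints.

(** * Invariance, and comparison at the generic point *)

Section Invariance.

Variables (k : fieldType) (n : nat) (H : 'M[k]_(n.*2)).
Hypotheses (char_k : [pchar k] =i pred0) (skH : H^T = - H) (uH : H \in unitmx).
Variable t : forall m, tensor k n.*2 m.*2.
Hypothesis ht : forall m, haar_tensor H (@t m).

Local Notation h := (haar_form t).

Lemma haar_form_mono_odd r (b a : mindex n.*2 r) : odd r -> h 'X_[mono b a] = 0.
Proof. by move=> ro; rewrite haar_form_odd // mdeg_mono. Qed.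

(** Translation by [g] acts on the row indices [a], in which the projector is a combination of
    copies of the [g]-invariant metric [D]. *)
Lemma haar_form_translate (B : comAlgType k) (g : 'M[B]_(n.*2)) p :
  Sp_point H g -> scalar_ext h (translate g p) = (h p)%:A.
Proof.
move=> /(Sp_point_dual uH) gD.
rewrite translateE scalar_ext_sum (scalar_formE p (haar_form_scalar t)).
rewrite scaler_suml; apply: eq_bigr => u _; rewrite scalar_extZ -scalerA.
rewrite -scalerAl mul1r; congr (_ *: _).
have [r [b [a ->]]] := monoP u; rewrite scalar_ext_translate.
have [ro|re] := boolP (odd r).
  rewrite haar_form_mono_odd // scale0r big1 // => c _.
  by rewrite haar_form_mono_odd // scale0r mulr0.
have re2 := odd_double_half r; rewrite (negbTE re) add0n in re2.
case: _ / re2 b a => b a; rewrite (haar_form_mono char_k ht).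
under eq_bigr do rewrite (haar_form_mono char_k ht).
have [e eE] := haar_tensor_rowD (ht r./2) b.
have mtA G y c : (@mtensor k n.*2 r./2 G y c)%:A = mtensor (map_mx (in_alg B) G) y c.
  by rewrite -[LHS]/(in_alg B _) rmorph_prod; apply: eq_bigr => i _; rewrite !mxE.
rewrite eE scaler_suml; under eq_bigr do rewrite eE scaler_suml mulr_sumr.
rewrite exchange_big; apply: eq_bigr => y _ /=.
rewrite -scalerA mtA -gD -tact_mtensor /tact scaler_sumr.
by apply: eq_bigr => c _; rewrite -scalerA mtA scalerAr.
Qed.

Lemma haar_form_invariant : invariant_integral H h.
Proof.
split; first exact: haar_form_scalar.
- by move=> p; apply: haar_form_ideal.
- by move=> B g gH p; apply: haar_form_translate.
- exact: haar_form1.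
Qed.

(** The invariance of [w] at the generic point is a congruence modulo the ideal. Applying [h] to it
    expresses [w] through the columns of the projector; these consist of copies of [H], on which [w]
    is known because it kills the ideal. *)
Lemma invariant_integral_unique w : invariant_integral H w -> w =1 h.
Proof.
case=> lw wI w_inv w1; apply: eq_scalar_form => //; first exact: haar_form_scalar.
have hI p : Sp_ideal H p -> h p = 0 by apply: haar_form_ideal.
have I1 : ~ Sp_ideal H 1.
  by move/wI/eqP; rewrite w1 oner_eq0.
have [B [f [fZ fI]]] := quotient_algebra (@Sp_ideal0 _ _ H) I1 (@Sp_idealMD _ _ H).
pose X := genX n.*2 k; pose HA := map_mx (@mpolyC (n.*2 * n.*2) k) H.
pose g := map_mx f X.
have fC c : f c%:MP = c%:A by rewrite -[c%:MP]mulr1 mul_mpolyC fZ rmorph1.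
have fE : map_mx f (X^T *m HA *m X) = map_mx f HA.
  apply/matrixP => i j; apply/eqP; rewrite -subr_eq0 !mxE -rmorphB; apply/eqP/fI.
  by have := Sp_ideal_gen H i j; rewrite /= !mxE.
have gP : Sp_point H g.
  rewrite /Sp_point /= (_ : map_mx _ H = map_mx f HA).
    by rewrite /g map_trmx -!map_mxM.
  by apply/matrixP => i j; rewrite !mxE fC.
have XE i j : X i j = 'X_(mxvec_index i j) by rewrite mxE.
move=> u; have [r [b [a ->]]] := monoP u.
have wE : \sum_c w 'X_[mono b c] * h 'X_[mono c a] = w 'X_[mono b a].
  (* The invariance relation of [w] at [g], lifted to polynomials. *)
  pose q := \sum_c w 'X_[mono b c] *: 'X_[mono c a] - (w 'X_[mono b a])%:MP.
  have /hI : Sp_ideal H q.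
    apply/fI; rewrite rmorphB rmorph_sum /= fC -(w_inv _ _ gP).
    rewrite scalar_ext_translate; apply/eqP; rewrite subr_eq0; apply/eqP.
    apply: eq_bigr => c _; rewrite fZ -scalerAr mulr1; congr (_ *: _).
    by rewrite mpolyX_mono rmorph_prod; apply: eq_bigr => j _; rewrite mxE XE.
  rewrite /q -[_%:MP]mulr1 mul_mpolyC addrC -scaleNr haar_form_scalar.
  rewrite (haar_form1 char_k ht) mulr1 addrC scalar_form_sum; last exact: haar_form_scalar.
  move/eqP; rewrite subr_eq0 => /eqP <-; apply: eq_bigr => c _.
  by rewrite scalar_formZ //; apply: haar_form_scalar.
rewrite -wE; have [ro|re] := boolP (odd r).
  by rewrite haar_form_mono_odd // big1 // => c _; rewrite haar_form_mono_odd // mulr0.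
have re2 := odd_double_half r; rewrite (negbTE re) add0n in re2.
case: _ / re2 b a {wE} => b a; rewrite (haar_form_mono char_k ht).
under eq_bigr do rewrite (haar_form_mono char_k ht).
have [e eE] := haar_tensor_colH (ht r./2) a.
rewrite eE; under eq_bigr do rewrite eE mulr_sumr.
rewrite exchange_big; apply: eq_bigr => z _ /=.
transitivity (e z * \sum_c mtensor H z c * w 'X_[mono b c]).
  by rewrite mulr_sumr; apply: eq_bigr => c _; rewrite mulrCA [_ * w _]mulrC.
congr (_ * _).
(* Modulo the ideal, the generic matrix preserves [H], hence every tensor made of copies of [H]. *)
pose q := \sum_c mtensor H z c *: 'X_[mono b c] - (mtensor H z b)%:MP.
have /wI : Sp_ideal H q.
  apply/fI; apply/eqP; rewrite /q rmorphB subr_eq0; apply/eqP.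
  transitivity (f (mtensor (X^T *m HA *m X^T^T) z b)).
    rewrite -tact_mtensor /tact; congr (f _); apply: eq_bigr => c _.
    rewrite -mul_mpolyC mulrC mpolyX_mono; congr (_ * _).
      by apply: eq_bigr => j _; rewrite !mxE.
    by rewrite rmorph_prod; apply: eq_bigr => i _; rewrite mxE.
  rewrite trmxK !rmorph_prod; apply: eq_bigr => i _.
  by have /matrixP/(_ (b (z (pos1 i))) (b (z (pos2 i)))) := fE; rewrite !mxE.
rewrite /q -[_%:MP]mulr1 mul_mpolyC addrC -scaleNr lw w1 mulr1 addrC.
rewrite scalar_form_sum // => /eqP; rewrite subr_eq0 => /eqP <-.
by apply: eq_bigr => c _; rewrite scalar_formZ.
Qed.

End Invariance.

(** * Pairs of matchings and cycle types *)

(* A union of two perfect matchings is a disjoint union of even cycles.       *)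
Lemma two_coloring (T : finType) (u v : {perm T}) :
    involutive u -> involutive v -> (forall z, u z != z) -> (forall z, v z != z) ->
  exists P : pred T, forall z, P (u z) = ~~ P z /\ P (v z) = ~~ P z.
Proof.
(* [g] moves two edges along a cycle of the union, so its orbits are the colour classes; the orbits
   of [z] and of [u z] differ because [u] and [v] have no fixed points. *)
move=> uu vv fu fv; pose g := (v * u)%g.
have gE z : g z = u (v z) by rewrite permM.
have ugu z : g (u (g z)) = u z by rewrite !gE uu vv.
have disj l z : u z != (g ^+ l)%g z.
  have [r] := ubnP l; elim: r l z => // r IH [|[|l]] z.
  - by rewrite expg0 perm1 fu.
  - by rewrite expg1 gE (inj_eq perm_inj) eq_sym fv.
  - move=> lr; apply/negP => /eqP uz.
    have /eqP[] := IH l (g z) (ltnW (lr : (l.+1 < r)%N)); apply: (@perm_inj _ g).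
    by rewrite ugu uz -permM -expgSr -permM -expgS.
have ndisj z : porbit g (u z) != porbit g z.
  rewrite eq_sym eq_porbit_mem porbit_sym.
  by apply/porbitP => - [l zl]; have /eqP := disj l z.
(* Of the two classes in a cycle, the one enumerated first is selected. *)
pose P z := (enum_rank (porbit g z) < enum_rank (porbit g (u z)))%N.
have Pu z : P (u z) = ~~ P z.
  rewrite /P uu -leqNgt ltn_neqAle; case: eqP => //= /val_inj/enum_rank_inj E.
  by have := ndisj z; rewrite E eqxx.
exists P => z; split=> //; rewrite -Pu.
have pg z' : porbit g (g z') = porbit g z'.
  by apply/eqP; rewrite eq_porbit_mem; have := mem_porbit g 1 z'; rewrite expg1.
have pvz : porbit g (v z) = porbit g (u z).
  by rewrite -[v z]uu -gE -pg ugu.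
by rewrite /P uu pvz -gE pg.
Qed.

Section FlipSet.

Variable m : nat.
Implicit Types (F : {set 'I_m}) (x : 'S_m.*2).

Definition flip_map F (j : 'I_m.*2) : 'I_m.*2 :=
  if half_pos j \in F then if odd j then pos1 (half_pos j) else pos2 (half_pos j)
  else j.

Lemma flip_mapK F : involutive (flip_map F).
Proof.
move=> j; have [jF|/negbTE jF] := boolP (half_pos j \in F); last first.
  by rewrite /flip_map !jF.
rewrite /flip_map jF; case: (boolP (odd j)) => oj.
  by rewrite half_pos1 jF odd_pos1 [RHS]posE oj.
by rewrite half_pos2 jF odd_pos2 [RHS]posE (negbTE oj).
Qed.

Definition flip_set F : 'S_m.*2 := perm (inv_inj (flip_mapK F)).

Lemma flip_setK F : involutive (flip_set F).
Proof. by move=> j; rewrite !permE flip_mapK. Qed.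

Lemma flip_set1 F i : flip_set F (pos1 i) = if i \in F then pos2 i else pos1 i.
Proof. by rewrite permE /flip_map half_pos1 odd_pos1. Qed.

Lemma flip_set2 F i : flip_set F (pos2 i) = if i \in F then pos1 i else pos2 i.
Proof. by rewrite permE /flip_map half_pos2 odd_pos2. Qed.

Lemma flip_set_D1 F i : i \in F ->
  flip_set F = (tperm (pos1 i) (pos2 i) * flip_set (F :\ i))%g.
Proof.
move=> iF; apply: pos_permP => j; rewrite permM.
  have [->|ji] := eqVneq j i.
    by rewrite tpermL flip_set1 flip_set2 iF !inE eqxx.
  rewrite tpermD ?pos21_neq ?(inj_eq (@pos1_inj m)) 1?eq_sym // !flip_set1.
  by rewrite !inE ji.
have [->|ji] := eqVneq j i.
  by rewrite tpermR flip_set1 flip_set2 iF !inE eqxx.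
rewrite tpermD ?pos12_neq ?(inj_eq (@pos2_inj m)) 1?eq_sym // !flip_set2.
by rewrite !inE ji.
Qed.

Lemma flip_set_ind (Q : {set 'I_m} -> Prop) :
  Q set0 -> (forall F i, i \in F -> Q (F :\ i) -> Q F) -> forall F, Q F.
Proof.
move=> Q0 QS F; have [l] := ubnP #|F|; elim: l F => // l IH F Fl.
have [->//|[i iF]] := set_0Vmem F.
by apply: (QS F i iF); apply: IH; rewrite (cardsD1 i) iF in Fl.
Qed.

Lemma flip_set0 : flip_set set0 = 1%g.
Proof. by apply: pos_permP => i; rewrite ?flip_set1 ?flip_set2 inE perm1. Qed.

Lemma odd_flip_set F : odd_perm (flip_set F) = odd #|F|.
Proof.
elim/flip_set_ind: F => [|F i iF IH]; first by rewrite flip_set0 odd_perm1 cards0.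
by rewrite (flip_set_D1 iF) odd_permM IH odd_tperm pos12_neq (cardsD1 i F) iF.
Qed.

Lemma mtensor_flip_set (R : comNzRingType) N (G : 'M[R]_N) F x c : G^T = - G ->
  mtensor G (flip_set F * x) c = (-1) ^+ #|F| * mtensor G x c.
Proof.
move=> skG; elim/flip_set_ind: F => [|F i iF IH].
  by rewrite flip_set0 mul1g cards0 mul1r.
rewrite (flip_set_D1 iF) -mulgA mtensor_flip // IH (cardsD1 i F) iF.
by rewrite exprS mulN1r mulNr.
Qed.

End FlipSet.

Section MatchingPairs.

Variables (k : fieldType) (n : nat) (H : 'M[k]_(n.*2)).
Hypotheses (skH : H^T = - H) (uH : H \in unitmx).
Let D := dual_metric H.
Let skD : D^T = - D. Proof. exact: dual_skew. Qed.

Definition pair_tensor m (y x : 'S_m.*2) : tensor k n.*2 m.*2 :=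
  fun b a => mtensor H y b * mtensor D x a.

Lemma HtensorE m (s : 'S_m) : Htensor H s =2 pair_tensor 1 (bipos 1 s).
Proof. by move=> b a; rewrite /Htensor !metric_tensorE bipos_id. Qed.

Lemma eq_symmetrize N r (t t' : tensor k N r) :
  t =2 t' -> symmetrize t =2 symmetrize t'.
Proof. by move=> tt b a; congr (_ * _); apply: eq_bigr => s _; rewrite tt. Qed.

Lemma symmetrizeZ N r (c : k) (t : tensor k N r) b a :
  symmetrize (fun b a => c * t b a) b a = c * symmetrize t b a.
Proof. by rewrite /symmetrize -mulr_sumr mulrCA. Qed.

Lemma symmetrize_pair_perm m (y x z : 'S_m.*2) :
  symmetrize (pair_tensor (y * z)%g (x * z)%g) =2 symmetrize (pair_tensor y x).
Proof.
move=> b a; congr (_ * _); rewrite [RHS](reindex_inj (mulgI z)) /=.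
apply: eq_bigr => s _; rewrite /pair_tensor -!mtensor_perm.
by congr (mtensor H y _ * mtensor D x _); apply/ffunP => j; rewrite !ffunE permM.
Qed.

(** Colour the positions so that each edge of both matchings has one end of either colour, then flip
    edges until the first ends all have the same colour. The matching [x] then joins first positions
    to second positions, and renumbering its copies gives some [bipos 1 s']. *)
Lemma matching_normal_form m (S : {set 'I_m}) (x : 'S_m.*2) (s : 'S_m) :
    {in S, forall i, s i \in S} ->
    (forall i, i \notin S -> x (pos1 i) = pos1 i /\ x (pos2 i) = pos2 (s i)) ->
  exists2 s' : 'S_m, forall i, i \notin S -> s' i = s i &
    forall b a, (-1) ^+ odd_perm x * symmetrize (pair_tensor 1 x) b a =
                (-1) ^+ odd_perm s' * symmetrize (Htensor H s') b a.
Proof.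
move=> sS xS.
have sSE i : (s i \in S) = (i \in S).
  apply/idP/idP => [siS|/sS //].
  have : s i \in s @: S.
    suff -> : s @: S = S by [].
    apply/eqP; rewrite eqEcard card_imset ?leqnn ?andbT; last exact: perm_inj.
    by apply/subsetP => _ /imsetP[j jS ->]; apply: sS.
  by rewrite mem_imset //; apply: perm_inj.
have xSE j : (half_pos (x j) \in S) = (half_pos j \in S).
  apply/idP/idP; apply: contraTT => jS.
    have [x1 x2] := xS _ jS; rewrite [j]posE; case: (odd j).
      by rewrite x2 half_pos2 sSE.
    by rewrite x1 half_pos1.
  case: (boolP (odd (x j))) => oj.
    have sS' : (s^-1 (half_pos (x j)))%g \notin S by rewrite -sSE permKV.
    have [_ x2] := xS _ sS'; rewrite permKV in x2.
    suff -> : j = pos2 (s^-1 (half_pos (x j)))%g by rewrite half_pos2.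
    by apply: (@perm_inj _ x); rewrite x2 {1}[x j]posE oj.
  have [x1 _] := xS _ jS.
  suff -> : j = pos1 (half_pos (x j)) by rewrite half_pos1.
  by apply: (@perm_inj _ x); rewrite x1 {1}[x j]posE (negbTE oj).
pose io := flip_set [set: 'I_m]; pose v := (x^-1 * io * x)%g.
have io1 i : io (pos1 i) = pos2 i by rewrite flip_set1 inE.
have io2 i : io (pos2 i) = pos1 i by rewrite flip_set2 inE.
have io_neq j : io j != j.
  by case: (pos_cases j) => i [] ->; rewrite ?io1 ?io2 ?pos21_neq ?pos12_neq.
have vE j : v j = x (io (x^-1 j)%g) by rewrite !permM.
have vv : involutive v by move=> j; rewrite !vE permK flip_setK permKV.
have v_neq j : v j != j.
  by rewrite vE -[X in _ != X](permKV x) (inj_eq perm_inj) io_neq.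
have [Q QE] := two_coloring (@flip_setK m _) vv io_neq v_neq.
(* Outside [S] the parity of positions already alternates, and keeping it there leaves [s]
   unchanged. *)
pose P j := if half_pos j \in S then Q j else ~~ odd j.
have P2 i : P (pos2 i) = ~~ P (pos1 i).
  rewrite /P half_pos1 half_pos2 odd_pos1 odd_pos2; case: ifP => // _.
  by rewrite -io1; have [] := QE (pos1 i).
have Px2 i : P (x (pos2 i)) = ~~ P (x (pos1 i)).
  rewrite /P !xSE half_pos1 half_pos2; case: ifPn => [_|iS].
    have [_ <-] := QE (x (pos1 i)); by rewrite vE permK io1.
  by have [-> ->] := xS i iS; rewrite odd_pos1 odd_pos2.
(* The edges to flip, in the standard matching and in [x] respectively. *)
pose F := [set i | ~~ P (pos1 i)]; pose F' := [set i | ~~ P (x (pos1 i))].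
pose z := (flip_set F' * x * flip_set F)%g.
have flipP1 j : P j -> flip_set F j = pos1 (half_pos j).
  case: (pos_cases j) => i [] -> Pi; rewrite ?half_pos1 ?half_pos2.
    by rewrite flip_set1 inE Pi.
  by rewrite flip_set2 inE -P2 Pi.
have flipP2 j : ~~ P j -> flip_set F j = pos2 (half_pos j).
  case: (pos_cases j) => i [] -> Pi; rewrite ?half_pos1 ?half_pos2.
    by rewrite flip_set1 inE Pi.
  by rewrite flip_set2 inE -P2 (negbTE Pi).
have z1 i : z (pos1 i) = pos1 (half_pos (z (pos1 i))).
  rewrite /z !permM flipP1 ?half_pos1 // flip_set1 inE.
  by case: ifPn => [|/negbNE] // Pi; rewrite Px2.
have z2 i : z (pos2 i) = pos2 (half_pos (z (pos2 i))).
  rewrite /z !permM flipP2 ?half_pos2 // flip_set2 inE.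
  by case: ifPn => [|/negbNE] // Pi; rewrite Px2 Pi.
have r_inj : injective (fun i => half_pos (z (pos1 i))).
  by move=> i j /(congr1 (@pos1 m)); rewrite -!z1 => /perm_inj/pos1_inj.
have q_inj : injective (fun i => half_pos (z (pos2 i))).
  by move=> i j /(congr1 (@pos2 m)); rewrite -!z2 => /perm_inj/pos2_inj.
pose r := perm r_inj; pose q := perm q_inj.
have rE i : r i = half_pos (z (pos1 i)) by rewrite permE.
have qE i : q i = half_pos (z (pos2 i)) by rewrite permE.
have zE : z = bipos r q.
  by apply: pos_permP => i; rewrite ?bipos1 ?bipos2 ?rE ?qE -?z1 -?z2.
have P1 i : i \notin S -> P (pos1 i) by move=> iS; rewrite /P half_pos1 (negbTE iS) odd_pos1.
exists (r^-1 * q)%g => [i iS|b a].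
  have zi j : j \notin S -> r j = j /\ q j = s j.
    move=> jS; have [x1 x2] := xS j jS; rewrite rE qE !permM.
    have jF' : j \notin F' by rewrite inE negbK x1 P1.
    have jF : j \notin F by rewrite inE negbK P1.
    have sjF : s j \notin F by rewrite inE negbK P1 // sSE.
    rewrite flip_set1 flip_set2 (negbTE jF') x1 x2 flip_set1 flip_set2.
    by rewrite (negbTE jF) (negbTE sjF) half_pos1 half_pos2.
  have [ri qi] := zi i iS; rewrite permM -qi; congr (q _).
  by rewrite -{1}ri permK.
(* A flip reverses the sign of the permutation and that of the tensor, so the signed tensor is
   preserved. *)
have sgnz : odd_perm x = odd_perm (r^-1 * q)%g (+) odd (#|F'| + #|F|).
  have := odd_bipos r q; rewrite -zE !odd_permM !odd_flip_set odd_permV oddD.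
  by do 4?case: (odd _); do 3?case: (odd_perm _).
rewrite (eq_symmetrize (HtensorE _)) -(symmetrize_pair_perm 1 x (flip_set F)).
rewrite sgnz signr_addb -mulrA; congr (_ * _); rewrite signr_odd exprD -mulrA.
have zD c : mtensor D (x * flip_set F)%g c = (-1) ^+ #|F'| * mtensor D z c.
  by rewrite /z -mulgA mtensor_flip_set // mulrA -exprD addnn -signr_odd odd_double mul1r.
have qD c : mtensor D z c = mtensor D (bipos 1 (r^-1 * q)) c.
  by rewrite zE -(mtensor_bipos D (bipos 1 _) r) biposM mulg1 mulKVg.
rewrite -!symmetrizeZ; apply: eq_symmetrize => {}b {}a; rewrite /pair_tensor.
rewrite mul1g -[X in mtensor H X]mulg1 mtensor_flip_set // zD qD.
have ee l : (-1) ^+ l * (-1) ^+ l = 1 :> k by rewrite -exprD addnn -signr_odd odd_double.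
rewrite [X in _ * X]mulrA [X in _ * (X * _)]mulrA ee mul1r mulrCA.
by rewrite [X in _ * X]mulrA ee mul1r.
Qed.

End MatchingPairs.

(** By the pigeonhole principle two positions of [S] carry the same index, and exchanging them
    cancels the terms in pairs. *)
Lemma sum_antisym (k : fieldType) (N r : nat) (S : {set 'I_r})
    (v : mindex N r -> k) (c : mindex N r) :
    2%:R != 0 :> k -> (N < #|S|)%N ->
  \sum_(y : 'S_r | perm_on S y) (-1) ^+ odd_perm y * v (mindex_perm y c) = 0.
Proof.
move=> two_neq0 NS.
have [i [j [iS jS ij cij]]] : exists i j, [/\ i \in S, j \in S, i != j & c i = c j].
  have /dinjectivePn[i iS [j]] : ~~ dinjectiveb c S.
    apply/negP => /dinjectiveP/card_in_imset cS; move: NS.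
    by rewrite -cS ltnNge -[X in (_ <= X)%N](card_ord N) max_card.
  by rewrite inE => /andP[ji jS] cij; exists i, j; split; rewrite // eq_sym.
set X := \sum_(_ | _) _.
suff XN : X = - X.
  have /eqP : 2%:R * X = 0 by rewrite mulr_natl mulr2n {1}XN addNr.
  by rewrite mulf_eq0 (negbTE two_neq0) => /eqP.
rewrite {1}/X (reindex_inj (mulIg (tperm i j))) /= -sumrN.
have ont : perm_on S (tperm i j).
  by apply: subset_trans (tperm_on i j) _; apply/subsetP => l; rewrite !inE => /orP[] /eqP ->.
apply: eq_big => [y|y _].
  apply/idP/idP => [yt|/perm_onM -> //].
  by rewrite -[y]mulg1 -(tperm2 i j) mulgA; apply: perm_onM.
rewrite odd_permM odd_tperm ij signr_addb mulrN1 mulNr; congr (- (_ * v _)).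
apply/ffunP => l; rewrite !ffunE permM.
by case: tpermP => [->|->|].
Qed.

(** * Cycles and cycle types of permutations *)

Section Cycles.

Variables (T : finType).
Implicit Types (s t : {perm T}) (C D : {set T}).

Lemma porbit_eq_on s t C x : C \in porbits s -> x \notin C ->
  {in [predC C], s =1 t} -> porbit t x = porbit s x.
Proof.
move=> /imsetP[z _ ->] xz st.
have it l : (t ^+ l)%g x = (s ^+ l)%g x.
  elim: l => [|l IH]; first by rewrite !expg0.
  rewrite !expgSr !permM IH st // inE; apply: contra xz => xl.
  by rewrite -eq_porbit_mem -(porbit_perm s l x) eq_porbit_mem.
by apply/setP => y; apply/porbitP/porbitP => - [l ->]; exists l; rewrite it.
Qed.

(** The other cycles of [s] are cycles of [t] as well, so [t] can only split [C]. *)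
Lemma porbits_refine s t C : C \in porbits s -> {in [predC C], s =1 t} ->
  (#|porbits s| <= #|porbits t|)%N /\
  (#|porbits t| = #|porbits s| -> porbits t = porbits s).
Proof.
move=> Cs st; case/imsetP: (Cs) => c _ CE.
have cC : c \in C by rewrite CE porbit_id.
have disj D : D \in porbits s :\ C -> exists x, [/\ x \notin C, D = porbit s x & c \notin D].
  rewrite !inE => /andP[DC /imsetP[x _ DE]]; exists x.
  have xC : x \notin C by apply: contraNN DC; rewrite DE CE eq_porbit_mem.
  by split=> //; rewrite DE porbit_sym -CE.
pose Q := porbit t c |: (porbits s :\ C).
have QE : #|Q| = #|porbits s|.
  rewrite (cardsD1 C (porbits s)) Cs cardsU1 [_ \in _](_ : _ = false) //.
  by apply/negP => /disj[x [_ _]]; rewrite porbit_id.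
have Qt : Q \subset porbits t.
  apply/subsetP => D /setU1P[->|/disj[x [xC -> _]]]; first exact: imset_f.
  by rewrite -(porbit_eq_on Cs xC st) imset_f.
split; first by rewrite -QE subset_leq_card.
rewrite -QE => tQ; have {}Qt : porbits t = Q.
  by apply/esym/eqP; rewrite eqEcard Qt tQ leqnn.
rewrite Qt /Q (_ : porbit t c = C) ?setD1K //.
apply/setP => x; apply/idP/idP => [xt|xC].
  apply/idPn => xC; have : c \in porbit t x by rewrite porbit_sym.
  by rewrite (porbit_eq_on Cs xC st) porbit_sym -CE (negbTE xC).
have : porbit t x \in Q by rewrite -Qt imset_f.
case/setU1P => [e|/disj[y [yC xy _]]]; first by rewrite -eq_porbit_mem e eqxx.
case/negP: yC; rewrite CE porbit_sym; have := porbit_id t x.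
rewrite xy -!eq_porbit_mem => /eqP <-; rewrite eq_sym eq_porbit_mem.
by rewrite -CE.
Qed.

End Cycles.

Section CycleType.

Variables (T : finType).
Implicit Types (s t : {perm T}) (C D : {set T}).

Definition cycle_type s : seq nat := [seq #|C| | C <- enum (porbits s)].

Lemma eq_iter_porbit s z i j :
  (iter i s z == iter j s z) = (i == j %[mod #|porbit s z|]).
Proof.
set d := #|_|; have d_gt0 : (0 < d)%N by rewrite lt0n card_porbit_neq0.
have red l : iter l s z = nth z (traject s z d) (l %% d).
  rewrite nth_traject ?ltn_mod // {1}(divn_eq l d) addnC iterD iterM.
  by rewrite [iter (l %/ d) _ _]iter_fix // iter_porbit.
by rewrite !red nth_uniq ?size_traject ?ltn_mod ?uniq_traject_porbit.
Qed.

(** Orbits of equal size are put in correspondence with chosen base points, and the conjugating map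
    sends the i-th iterate of a base point to the i-th iterate of its counterpart. *)
Lemma cycle_type_conj s t : perm_eq (cycle_type s) (cycle_type t) ->
  exists x, t = (s ^ x)%g.
Proof.
move=> st; pose ord C D := (#|C| <= #|D|)%N.
pose es := sort ord (enum (porbits s)); pose et := sort ord (enum (porbits t)).
have es_et : [seq #|(C : {set T})| | C <- es] = [seq #|(C : {set T})| | C <- et].
  have sorted_ord u : sorted leq [seq #|(C : {set T})| | C <- sort ord u].
    by rewrite sorted_map; apply: sort_sorted => C D; apply: leq_total.
  apply: (sorted_eq leq_trans anti_leq (sorted_ord _) (sorted_ord _)).
  rewrite /es /et; apply: perm_trans (perm_trans _ st) _.
    by apply: perm_map; rewrite perm_sort.
  by rewrite perm_sym; apply: perm_map; rewrite perm_sort.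
have szE : size es = size et by have /(congr1 size) := es_et; rewrite !size_map.
have mem_es C : (C \in es) = (C \in porbits s) by rewrite mem_sort mem_enum.
have mem_et C : (C \in et) = (C \in porbits t) by rewrite mem_sort mem_enum.
(* Both lists are sorted by size, so orbits of the same rank have the same size. *)
pose phi C := nth set0 et (index C es).
have phi_lt C : C \in porbits s -> (index C es < size et)%N.
  by move=> Cs; rewrite -szE index_mem mem_es.
have phi_t C : C \in porbits s -> phi C \in porbits t.
  by move=> Cs; rewrite -mem_et mem_nth // phi_lt.
have phi_card C : C \in porbits s -> #|phi C| = #|C|.
  move=> Cs; have Cl := phi_lt _ Cs.
  rewrite /phi -(nth_map _ 0%N (fun C : {set T} => #|C|)) // -es_et.
  by rewrite (nth_map set0) ?szE // nth_index // mem_es.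
have phi_inj : {in porbits s &, injective phi}.
  move=> C D Cs Ds /eqP; rewrite nth_uniq ?phi_lt // ?sort_uniq ?enum_uniq //.
  by move/eqP => CD; rewrite -[C](nth_index set0 (s := es)) ?mem_es // CD nth_index ?mem_es.
(* [z] is only a default value: on a nonempty [C] the base point depends on [C] alone. *)
pose root C z := odflt z [pick x in C].
have rootP C z y : y \in C -> root C z \in C.
  by move=> yC; rewrite /root; case: pickP => [//|/(_ y)]; rewrite yC.
have rootE C z z' y : y \in C -> root C z = root C z'.
  by move=> yC; rewrite /root; case: pickP => [//|/(_ y)]; rewrite yC.
pose C z := porbit s z; pose R z := root (C z) z; pose R' z := root (phi (C z)) z.
have Cs z : C z \in porbits s by apply: imset_f.
have CR z : porbit s (R z) = C z.
  by apply/eqP; rewrite eq_porbit_mem; apply: rootP (porbit_id s z).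
have phi_mem z : exists y, y \in phi (C z).
  by apply/set0Pn; rewrite -card_gt0 phi_card // lt0n card_porbit_neq0.
have CR' z : porbit t (R' z) = phi (C z).
  have [y yC] := phi_mem z; have /imsetP[x _ E] := phi_t _ (Cs z).
  by apply/eqP; rewrite E eq_porbit_mem -E; apply: rootP yC.
pose ix z := index z (traject s (R z) #|C z|).
have ixE z : iter (ix z) s (R z) = z.
  have zt : z \in traject s (R z) #|C z|.
    by rewrite -CR -porbit_traject CR porbit_id.
  have := nth_index (R z) zt; rewrite nth_traject //.
  by rewrite -{2}(size_traject s (R z) #|C z|) index_mem.
pose g z := iter (ix z) t (R' z).
have gE z i : g (iter i s (R z)) = iter i t (R' z).
  set w := iter i s (R z).
  have Cw : C w = C z by rewrite /C /w -permX porbit_perm CR.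
  have Rw : R w = R z by rewrite /R Cw; apply: rootE (porbit_id s z).
  have R'w : R' w = R' z.
    by have [y yC] := phi_mem z; rewrite /R' Cw; apply: rootE yC.
  apply/eqP; rewrite /g R'w eq_iter_porbit CR' phi_card // -CR -eq_iter_porbit.
  by rewrite -{1}Rw ixE.
have gs z : g (s z) = t (g z).
  by rewrite -{1}[z]ixE -iterS gE iterS.
have Cg z : porbit t (g z) = phi (C z) by rewrite /g -permX porbit_perm CR'.
have g_inj : injective g.
  move=> z w gzw; have Czw : C z = C w.
    by apply: phi_inj => //; rewrite -!Cg gzw.
  have Rzw : R z = R w by rewrite /R Czw; apply: rootE (porbit_id s w).
  have R'zw : R' z = R' w.
    by have [y yC] := phi_mem w; rewrite /R' Czw; apply: rootE yC.
  move/eqP: gzw; rewrite /g R'zw eq_iter_porbit CR' phi_card // -CR.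
  by rewrite -eq_iter_porbit -{1}Rzw !ixE => /eqP.
exists (perm g_inj); apply/permP => z.
rewrite -[z](permKV (perm g_inj)); move: ((perm g_inj)^-1 z)%g => w.
by rewrite permJ !permE gs.
Qed.

End CycleType.

(** * The classes with short cycles span *)

Section Spanning.

Variables (k : fieldType) (n m : nat) (H : 'M[k]_(n.*2)).
Hypotheses (char_k : [pchar k] =i pred0) (skH : H^T = - H) (uH : H \in unitmx).
Let D := dual_metric H.
Implicit Types (s : 'S_m) (C : {set 'I_m}).

Local Notation symH s := (symmetrize (Htensor H s)).

Lemma symmetrize_Htensor_conj s x : symH (s ^ x)%g =2 symH s.
Proof.
move=> b a; rewrite /symmetrize; congr (_ * _).
rewrite [RHS](reindex_inj (mulgI (pos_perm x))) /=; apply: eq_bigr => t _.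
by rewrite Htensor_conj; congr Htensor; apply/ffunP => j; rewrite !ffunE permM.
Qed.

Definition cycle_positions C : {set 'I_m.*2} := [set j | half_pos j \in C].

Lemma card_cycle_positions C : #|cycle_positions C| = #|C|.*2.
Proof.
rewrite -sum1_card big_pos -(addnn #|C|) -(sum1_card (mem C)) -big_split [RHS]big_mkcond /=.
by apply: eq_bigr => i _; rewrite !inE half_pos1 half_pos2; case: ifP.
Qed.

(* The antisymmetrization of a tensor over more than 2n positions vanishes:   *)
(* for the positions of a cycle of length > n, this is a linear relation in   *)
(* which the terms that are not conjugate to s have more cycles than s.       *)
Lemma long_cycle_relation s C : C \in porbits s -> (n < #|C|)%N ->
  exists (P : pred 'S_m.*2) (f : 'S_m.*2 -> 'S_m), [/\ P 1%g, f 1%g = s,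
    forall y, P y -> {in [predC C], s =1 f y} &
    forall b a, \sum_(y | P y) (-1) ^+ odd_perm (f y) * symH (f y) b a = 0].
Proof.
move=> Cs nC; pose P := perm_on (cycle_positions C).
pose x (y : 'S_m.*2) := (bipos 1 s * y)%g.
have sCE i : (s i \in C) = (i \in C).
  case/imsetP: Cs => c _ ->; rewrite -!eq_porbit_mem.
  by have := porbit_perm s 1 i; rewrite expg1 => ->.
have fE y : exists f : 'S_m, (P y -> [/\ y = 1%g -> f = s, {in [predC C], s =1 f} &
    forall b a, (-1) ^+ odd_perm (x y) * symmetrize (pair_tensor H 1 (x y)) b a =
                (-1) ^+ odd_perm f * symH f b a]).
  (* At [y = 1] the normal form is taken to be [s] itself, so that [s] occurs in the relation. *)
  have [->|y1] := eqVneq y 1%g.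
    exists s => _; split=> // b a; rewrite /x mulg1 odd_bipos odd_perm1 addFb.
    by rewrite (eq_symmetrize (HtensorE H s)).
  have [Py|nPy] := boolP (P y); last by exists s => Py; case/negP: nPy.
  have [||f fs fE] := @matching_normal_form _ _ _ skH uH _ C (x y) s.
  - by move=> i; rewrite sCE.
  - move=> i iC; have yid j : half_pos j \notin C -> y j = j.
      by move=> jC; apply: (out_perm Py); rewrite inE.
    by rewrite !permM bipos1 bipos2 perm1 !yid ?half_pos1 ?half_pos2 ?sCE.
  - exists f => _; split=> //; first by move/eqP; rewrite (negbTE y1).
    by move=> i; rewrite inE => iC; rewrite fs.
have /fin_all_exists[f {}fE] := fE.
have P1 : P 1%g by apply: perm_on1.
exists P, f; split=> //; first by have [->] := fE _ P1.
  by move=> y /fE[].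
move=> b a; transitivity (\sum_(y | P y) (-1) ^+ odd_perm s *
    ((-1) ^+ odd_perm y * symmetrize (pair_tensor H 1 (x y)) b a)).
  apply: eq_bigr => y /fE [_ _ <-]; rewrite mulrA; congr (_ * _).
  by rewrite /x odd_permM odd_bipos odd_perm1 addFb signr_addb.
rewrite -mulr_sumr /symmetrize; under eq_bigr do rewrite mulrCA mulr_sumr.
rewrite -mulr_sumr exchange_big big1 ?mulr0 // => z _ /=.
set b' := [ffun _ => _]; set a' := [ffun _ => _]; rewrite /pair_tensor.
transitivity (mtensor H 1 b' * \sum_(y | P y) (-1) ^+ odd_perm y *
    mtensor D (bipos 1 s) (mindex_perm y a')).
  by rewrite mulr_sumr; apply: eq_bigr => y _; rewrite -(mtensor_perm D) mulrCA.
rewrite sum_antisym ?mulr0 //; first exact: two_neq0 char_k.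
by rewrite card_cycle_positions ltn_double.
Qed.

Definition short_span (T : tensor k n.*2 m.*2) : Prop :=
  exists c : 'I_#|Sprime n m| -> k, forall b a,
    T b a = \sum_i c i * symH (rep i) b a.

Lemma short_span_sum (I : finType) (P : pred I) (c : I -> k)
    (T : I -> tensor k n.*2 m.*2) :
  (forall i, P i -> short_span (T i)) ->
  short_span (fun b a => \sum_(i | P i) c i * T i b a).
Proof.
move=> PT; have /fin_all_exists[d dE] : forall i, exists d : 'I_#|Sprime n m| -> k, P i ->
    forall b a, T i b a = \sum_i d i * symH (rep i) b a.
  move=> i; have [/PT[d dE]|nPi] := boolP (P i); first by exists d.
  by exists (fun=> 0).
exists (fun j => \sum_(i | P i) c i * d i j) => b a.
under [RHS]eq_bigr do rewrite mulr_suml.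
rewrite [RHS]exchange_big; apply: eq_bigr => i Pi /=.
by rewrite dE // mulr_sumr; apply: eq_bigr => j _; rewrite mulrA.
Qed.

Lemma rep_conj (i : 'I_#|Sprime n m|) (s : 'S_m) :
  enum_val i = (s ^: [set: 'S_m])%g -> exists x, rep i = (s ^ x)%g.
Proof.
move=> iE; rewrite /rep iE.
by have /imsetP[x _ ->] := mem_repr s (class_refl [set: 'S_m] s); exists x.
Qed.

(** Induction on [m] minus the number of cycles. In the relation of a long cycle, the terms with as
    many cycles as [s] have the same orbits, hence are conjugate to [s]; all others have more
    cycles. *)
Lemma symmetrize_Htensor_span s : short_span (symH s).
Proof.
have [l] := ubnP (m - #|porbits s|); elim: l s => // l IH s sl.
have [sn|] := boolP [forall C in porbits s, #|C| <= n]%N.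
  have sS : (s ^: [set: 'S_m])%g \in Sprime n m by apply: imset_f; rewrite inE.
  pose i := enum_rank_in sS (s ^: [set: 'S_m])%g.
  have [x xE] : exists x, rep i = (s ^ x)%g.
    by apply: rep_conj; rewrite enum_rankK_in.
  exists (fun j => (j == i)%:R) => b a; rewrite (bigD1 i) //= eqxx mul1r xE.
  rewrite symmetrize_Htensor_conj big1 ?addr0 // => j /negbTE ->.
  by rewrite mul0r.
case/forall_inPn => C Cs; rewrite -ltnNge => nC.
have [P [f [P1 f1 fs rel]]] := long_cycle_relation Cs nC.
pose Q y := P y && (#|porbits (f y)| == #|porbits s|).
pose T b a := \sum_(y | P y && (#|porbits (f y)| != #|porbits s|))
   (-1) ^+ odd_perm (f y) * symH (f y) b a.
have [c cE] : short_span T.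
  apply: short_span_sum => y /andP[Py ny]; apply: IH.
  have [le _] := porbits_refine Cs (fs _ Py).
  have lt : (#|porbits s| < #|porbits (f y)|)%N by rewrite ltn_neqAle eq_sym ny.
  have lm : (#|porbits (f y)| <= m)%N.
    by apply: leq_trans (leq_imset_card _ _) _; rewrite card_ord.
  rewrite ltnS in sl; apply: leq_trans sl; apply: ltn_sub2l => //.
  exact: leq_trans lt lm.
(* The terms conjugate to [s] all occur with the sign of [s], so they cannot cancel in
   characteristic zero. *)
pose q : k := #|[pred y | Q y]|%:R.
have q0 : q != 0.
  rewrite /q ((pcharf0P k).1 char_k) -lt0n; apply/card_gt0P; exists 1%g.
  by rewrite inE /Q P1 f1 eqxx.
exists (fun i => - (-1) ^+ odd_perm s / q * c i) => b a.
transitivity (- (-1) ^+ odd_perm s / q * \sum_i c i * symH (rep i) b a);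
  last by rewrite mulr_sumr; apply: eq_bigr => i _; rewrite mulrA.
rewrite -cE; apply: (mulfI q0).
have := rel b a; rewrite (bigID (fun y => #|porbits (f y)| == #|porbits s|)) /=.
rewrite -/(T b a) (eq_bigr (fun=> (-1) ^+ odd_perm s * symH s b a)) => [|y]; last first.
  case/andP => Py /eqP fy; have [_ /(_ fy) py] := porbits_refine Cs (fs _ Py).
  have -> : odd_perm (f y) = odd_perm s by rewrite /odd_perm fy.
  have [x ->] : exists x, f y = (s ^ x)%g.
    by apply: cycle_type_conj; rewrite /cycle_type py.
  by rewrite symmetrize_Htensor_conj.
rewrite sumr_const -mulr_natl -/q => /eqP; rewrite addr_eq0 => /eqP E.
rewrite [RHS]mulrA [q * (_ / _)]mulrC divfK // mulNr -mulrN -E [RHS]mulrCA.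
by congr (_ * _); rewrite mulrA -signr_addb addbb mul1r.
Qed.

End Spanning.

(** * Linear independence *)

Section PowerSums.

Variables (k : fieldType) (n : nat).
Hypothesis char_k : [pchar k] =i pred0.
Local Notation L := {mpoly k[n]}.
Implicit Types F : L.

Definition psum (e : nat) : L := \sum_(l < n) 'X_l ^+ e.
Definition psums : n.-tuple L := [tuple psum j.+1 | j < n].

Lemma mderiv_var i j : mderiv i ('X_j : L) = (j == i)%:R.
Proof.
rewrite mderivX mnm1E; case: eqP => [->|_]; last by rewrite scale0r.
rewrite scale1r (_ : (_ - _)%MM = 0%MM) ?mpolyX0 //.
by apply/mnmP => l; rewrite mnmBE subnn mnm0E.
Qed.

Lemma mderiv_exp i (p : L) e :
  mderiv i (p ^+ e.+1) = e.+1%:R * p ^+ e * mderiv i p.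
Proof.
elim: e => [|e IH]; first by rewrite expr1 expr0 mulr1 mul1r.
rewrite exprS mderivM IH exprS -[e.+2]add1n natrD -[RHS]mulrA mulrDl mul1r.
by congr (_ + _); [rewrite mulrC | rewrite -!mulrA mulrCA].
Qed.

Lemma mderiv_psum i e : mderiv i (psum e.+1) = e.+1%:R * 'X_i ^+ e.
Proof.
rewrite /psum raddf_sum (bigD1 i) //= big1 => [|l li].
  by rewrite addr0 mderiv_exp mderiv_var eqxx mulr1.
by rewrite mderiv_exp mderiv_var (negbTE li) mulr0.
Qed.

Lemma mderiv_comp (q : n.-tuple L) F i :
  mderiv i (F \mPo q) = \sum_j (mderiv j F \mPo q) * mderiv i (tnth q j).
Proof.
pose K (p : L) := forall i,
  mderiv i (p \mPo q) = \sum_j (mderiv j p \mPo q) * mderiv i (tnth q j).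
have K1 : K 1.
  move=> l; rewrite comp_mpoly1 -mpolyC1 mderivC big1 // => j _.
  by rewrite mderivC comp_mpoly0 mul0r.
have KM p p' : K p -> K p' -> K (p * p').
  move=> Kp Kp' l; rewrite rmorphM mderivM Kp Kp' mulr_suml mulr_sumr -big_split.
  apply: eq_bigr => j _; rewrite mderivM rmorphD !rmorphM /= mulrDl.
  by congr (_ + _); [rewrite mulrAC | rewrite mulrA].
have KX j : K 'X_j.
  move=> l; rewrite comp_mpolyXU -tnth_nth (bigD1 j) //= big1 => [|j' jj].
    by rewrite addr0 mderiv_var eqxx comp_mpoly1 mul1r.
  by rewrite mderiv_var eq_sym (negbTE jj) comp_mpoly0 mul0r.
have KXn u : K 'X_[u].
  rewrite (mpolyXE _ 1%g); apply: (big_ind K K1 KM) => j _; rewrite perm1.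
  by elim: (u j) => [|e IH]; [rewrite expr0 | rewrite exprS; apply/KM/IH/KX].
have K0 : K 0 by move=> l; rewrite comp_mpoly0 mderiv0 big1 // => j _; rewrite mderiv0 comp_mpoly0 mul0r.
have KD p p' : K p -> K p' -> K (p + p').
  move=> Kp Kp' l; rewrite comp_mpolyD mderivD Kp Kp' -big_split.
  by apply: eq_bigr => j _; rewrite mderivD comp_mpolyD mulrDl.
have KZ c p : K p -> K (c *: p).
  move=> Kp l; rewrite comp_mpolyZ mderivZ Kp scaler_sumr.
  by apply: eq_bigr => j _; rewrite mderivZ comp_mpolyZ scalerAl.
suff: K F by apply.
by rewrite [F]mpolyE; apply: (big_ind K K0 KD) => u _; apply/KZ/KXn.
Qed.

Lemma psums_const F : F \mPo psums = 0 -> (forall j, mderiv j F = 0) -> F = 0.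
Proof.
move=> F0 dF0; have E : F = (F@_0%MM)%:MP.
  apply/mpolyP => u; rewrite mcoeffC.
  have [->|u0] := eqVneq u 0%MM; first by rewrite mulr1.
  rewrite mulr0; have [j uj] : exists j, u j != 0%N.
    apply/existsP; apply: contraR u0 => /existsPn u0.
    by apply/eqP/mnmP => j; rewrite mnm0E; apply/eqP/negPn/u0.
  have /(congr1 (mcoeff (u - U_(j))%MM)) := dF0 j.
  rewrite mcoeff_mderiv mcoeff0 submK ?lep1mP // => /eqP.
  by rewrite -mulr_natr mulf_eq0 ((pcharf0P k).1 char_k) orbF => /eqP.
by move: F0; rewrite E comp_mpolyC.
Qed.

(* The Jacobian of the power sums is a Vandermonde determinant, up to n!.     *)
Lemma psums_free F : F \mPo psums = 0 -> F = 0.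
Proof.
have [d Fd] : exists d, forall u, (d < mdeg u)%N -> F@_u = 0.
  by exists (msize F) => u Fu; apply/memN_msupp_eq0/msize_mdeg_ge/ltnW.
elim: d F Fd => [|d IH] F Fd F0; apply: psums_const => // j.
  apply/mpolyP => u; rewrite mcoeff_mderiv mcoeff0 Fd ?mul0rn //.
  by rewrite mdegD mdeg1 addn1.
apply: IH => [u du|].
  by rewrite mcoeff_mderiv Fd ?mul0rn // mdegD mdeg1 addn1 ltnS.
(* By the chain rule [G *m V] is the gradient of [F \mPo psums]; multiplying by the adjugate of [V]
   shows that [G] vanishes. *)
pose V := Vandermonde n (\row_i ('X_i : L)).
pose G : 'rV[L]_n := \row_j ((mderiv j F \mPo psums) * j.+1%:R).
have GV : G *m V = 0.
  apply/rowP => i; rewrite mxE [RHS]mxE.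
  transitivity (mderiv i (F \mPo psums)); last by rewrite F0 mderiv0.
  rewrite mderiv_comp; apply: eq_bigr => l _.
  by rewrite !mxE tnth_mktuple mderiv_psum mulrA.
have V0 : \det V != 0.
  rewrite det_Vandermonde; apply/prodf_neq0 => i _; apply/prodf_neq0 => l il.
  rewrite !mxE subr_eq0; apply/eqP => /(congr1 (mcoeff U_(l)%MM)) /eqP.
  have neq_il : (i == l) = false by apply: contraTF il => /eqP ->; rewrite ltnn.
  by rewrite !mcoeffXU eqxx neq_il oner_eq0.
have /rowP/(_ j) : \det V *: G = 0.
  by rewrite -mul_mx_scalar -mul_mx_adj mulmxA GV mul0mx.
rewrite !mxE => /eqP; rewrite mulf_eq0 (negbTE V0) /= mulf_eq0 => /orP[/eqP //|].
by rewrite -mpolyC_nat mpolyC_eq0 ((pcharf0P k).1 char_k).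
Qed.

End PowerSums.

(** * Contractions along cycles *)

Section CycleSums.

Variables (R : comNzRingType) (T M : finType) (x : M -> R).
Implicit Types (s : {perm T}).

Lemma cycle_invariant s (f : {ffun T -> M}) : (forall i, f (s i) = f i) ->
  forall i j, j \in porbit s i -> f j = f i.
Proof.
move=> fs i j /porbitP[l ->]; elim: l => [|l IH]; first by rewrite expg0 perm1.
by rewrite expgSr permM fs.
Qed.

(** Only the maps that are constant on the cycles contribute, and the value on each cycle is chosen
    freely. *)
Lemma sum_cycle_ffun s :
  \sum_(f : {ffun T -> M}) \prod_i (x (f i) * (f (s i) == f i)%:R) =
  \prod_(C in porbits s) \sum_l x l ^+ #|C|.
Proof.
pose O := {C in porbits s}.
have orbP i : porbit s i \in porbits s by apply: imset_f.
pose orb i : O := exist _ (porbit s i) (orbP i).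
have [rp rpE] : exists rp : O -> T, forall C, orb (rp C) = C.
  have: forall C : O, exists i, orb i = C.
    case=> C Cs; have /imsetP[i _ CE] := Cs.
    by exists i; apply: val_inj; rewrite /= CE.
  by move/fin_all_exists => [rp rpE]; exists rp.
rewrite [RHS]big_sub [RHS]bigA_distr_bigA /=.
pose h (g : {ffun O -> M}) : {ffun T -> M} := [ffun i => g (orb i)].
pose h' (f : {ffun T -> M}) : {ffun O -> M} := [ffun C => f (rp C)].
have orb_s i : orb (s i) = orb i.
  by apply: val_inj; rewrite /=; have := porbit_perm s 1 i; rewrite expg1.
have hs g i : h g (s i) = h g i by rewrite !ffunE orb_s.
rewrite (bigID (fun f : {ffun T -> M} => [forall i, f (s i) == f i])) /=.
rewrite [X in _ + X]big1 ?addr0 => [|f /forallPn[i /negbTE fi]]; last first.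
  by rewrite (bigD1 i) //= fi mulr0 mul0r.
rewrite (reindex_onto h h') /= => [|f /forallP fs]; last first.
  apply/ffunP => i; rewrite !ffunE; apply: (@cycle_invariant s) => [j|].
    exact/eqP.
  by have /(congr1 val) /= <- := rpE (orb i); apply: porbit_id.
apply: eq_big => [g|g _].
  apply/andP; split; first by apply/forallP => i; rewrite hs.
  by apply/eqP/ffunP => C; rewrite !ffunE rpE.
under eq_bigr do rewrite hs eqxx mulr1 ffunE.
rewrite (partition_big orb xpredT) //=; apply: eq_bigr => C _.
rewrite (eq_bigr (fun=> x (g C))) => [|i /eqP -> //].
rewrite prodr_const; congr (_ ^+ _); apply: eq_card => i.
have [j _ CE] := imsetP (valP C).
transitivity (orb i == C); first by [].
transitivity (i \in val C); last by [].
by rewrite -val_eqE CE -eq_porbit_mem.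

Qed.

End CycleSums.

Lemma prod_by_size (R : comNzRingType) (I : finType) (A : {set I}) (n : nat)
    (sz : I -> nat) (g : nat -> R) : {in A, forall i, 0 < sz i <= n}%N ->
  \prod_(i in A) g (sz i) =
  \prod_(j < n) g j.+1 ^+ #|[set i in A | sz i == j.+1]|.
Proof.
move=> Asz; under [RHS]eq_bigr => j _.
  rewrite -prodr_const (eq_bigr (fun i => g (sz i))) => [|i]; last first.
    by rewrite inE => /andP[_ /eqP ->].
  rewrite (eq_bigl (fun i => (i \in A) && (sz i == j.+1))) => [|i]; last by rewrite inE.
  over.
rewrite (exchange_big_dep (mem A)) /= => [|j i _ /andP[] //].
apply: eq_bigr => i iA; have /andP[sz0 szn] := Asz i iA.
have szn' : ((sz i).-1 < n)%N by rewrite prednK.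
rewrite (big_pred1 (Ordinal szn')) // => j /=.
rewrite iA /=; apply/eqP/eqP => [e|->]; last by rewrite /= prednK.
by apply: val_inj; rewrite /= e.
Qed.

Section CycleContraction.

Variables (R : comNzRingType) (N m : nat).
Implicit Types (S D : 'M[R]_N) (s : 'S_m).

(** Summing over the indices in second positions leaves one factor [S *m D^T] per edge of the cycles
    of [s]. *)
Lemma tdot_mtensor_cycle S D s :
  tdot (mtensor S 1) (mtensor D (bipos 1 s)) =
  \sum_(f : {ffun 'I_m -> 'I_N}) \prod_i (S *m D^T) (f i) (f (s^-1 i)%g).
Proof.
rewrite /tdot.
pose spl (u : {ffun 'I_m -> 'I_N} * {ffun 'I_m -> 'I_N}) : mindex N m.*2 :=
  [ffun j : 'I_m.*2 => if odd j then u.2 (half_pos j) else u.1 (half_pos j)].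
pose uns (a : mindex N m.*2) :=
  ([ffun i => a (pos1 i)] : {ffun 'I_m -> 'I_N},
   [ffun i => a (pos2 i)] : {ffun 'I_m -> 'I_N}).
rewrite (reindex spl); last first.
  exists uns => [[f g] _|a _].
    by congr (_, _); apply/ffunP => i; rewrite !ffunE ?odd_pos1 ?odd_pos2 ?half_pos1 ?half_pos2.
  by apply/ffunP => j; rewrite !ffunE [in RHS](posE j); case: ifP.
have spl1 f g i : spl (f, g) (pos1 i) = f i by rewrite ffunE odd_pos1 half_pos1.
have spl2 f g i : spl (f, g) (pos2 i) = g i by rewrite ffunE odd_pos2 half_pos2.
rewrite -(pair_bigA _ (fun f g => mtensor _ 1 (spl (f, g)) * mtensor _ _ (spl (f, g)))).
apply: eq_bigr => f _; rewrite /mtensor.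
transitivity (\sum_(g : {ffun 'I_m -> 'I_N}) \prod_i
   (S (f i) (g i) * D (f (s^-1 i)%g) (g i))).
  apply: eq_bigr => g _ /=.
  rewrite [X in _ * X](reindex_inj (@perm_inj _ (s^-1)%g)) -big_split.
  apply: eq_bigr => i _ /=.
  by rewrite !perm1 bipos1 bipos2 perm1 permKV !spl1 !spl2.
rewrite -(bigA_distr_bigA (fun i q => S (f i) q * D (f (s^-1 i)%g) q)) /=.
by apply: eq_bigr => i _; rewrite mxE; apply: eq_bigr => q _; rewrite mxE.
Qed.

Lemma tdot_mtensor_diag S D (x : 'rV[R]_N) s : S *m D^T = diag_mx x ->
  tdot (mtensor S 1) (mtensor D (bipos 1 s)) =
  \prod_(C in porbits s) \sum_l x 0 l ^+ #|C|.
Proof.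
move=> SD; rewrite tdot_mtensor_cycle SD -porbitsV -sum_cycle_ffun.
apply: eq_bigr => f _; apply: eq_bigr => i _; rewrite mxE eq_sym.
by rewrite mulr_natr.
Qed.

End CycleContraction.

(** * Independence of the classes with short cycles *)

Section LinearIndependence.

Variables (k : fieldType) (n m : nat) (H : 'M[k]_(n.*2)).
Hypotheses (char_k : [pchar k] =i pred0) (skH : H^T = - H) (uH : H \in unitmx).
Let D := dual_metric H.
Local Notation L := {mpoly k[n]}.
Implicit Types s : 'S_m.

(** The value of a polynomial function at an endomorphism with polynomial entries, so that
    eigenvalues can be indeterminates. *)
Definition tensor_val r (t : tensor k n.*2 r) (T : 'M[L]_(n.*2)) : L :=
  \sum_b \sum_a t b a *: \prod_(j < r) T (b j) (a j).

Lemma tensor_val_symmetrize r (t : tensor k n.*2 r) T :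
  tensor_val (symmetrize t) T = tensor_val t T.
Proof.
transitivity (r`!%:R^-1 *: \sum_(s : 'S_r) tensor_val t T).
  rewrite /tensor_val /symmetrize.
  under eq_bigr do under eq_bigr do rewrite -scalerA scaler_suml.
  under eq_bigr do rewrite -scaler_sumr exchange_big.
  rewrite -scaler_sumr exchange_big; congr (_ *: _); apply: eq_bigr => s _ /=.
  rewrite [RHS](reindex_inj (@mindex_perm_inj _ _ s)); apply: eq_bigr => b _ /=.
  rewrite [RHS](reindex_inj (@mindex_perm_inj _ _ s)); apply: eq_bigr => a _ /=.
  congr (_ *: _); rewrite (reindex_inj (@perm_inj _ s)).
  by apply: eq_bigr => j _; rewrite !ffunE.
rewrite sumr_const card_Sn -scaler_nat scalerA mulVf ?scale1r //.
by rewrite ((pcharf0P k).1 char_k) -lt0n fact_gt0.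
Qed.

Lemma tensor_val_sum (I : finType) (c : I -> k) r (t : I -> tensor k n.*2 r) T :
  tensor_val (fun b a => \sum_i c i * t i b a) T = \sum_i c i *: tensor_val (t i) T.
Proof.
rewrite /tensor_val; under [RHS]eq_bigr do rewrite scaler_sumr.
rewrite [RHS]exchange_big; apply: eq_bigr => b _ /=.
under [RHS]eq_bigr do rewrite scaler_sumr.
rewrite [RHS]exchange_big; apply: eq_bigr => a _ /=.
by rewrite scaler_suml; apply: eq_bigr => i _; rewrite scalerA.
Qed.

Lemma tensor_val_Htensor s (T : 'M[L]_(n.*2)) :
  tensor_val (Htensor H s) T =
  tdot (mtensor (T^T *m map_mx (@mpolyC n k) H *m T) 1)
       (mtensor (map_mx (@mpolyC n k) D) (bipos 1 s)).
Proof.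
have mtC G x c : (@mtensor k n.*2 m G x c)%:MP = mtensor (map_mx (@mpolyC n k) G) x c.
  by rewrite rmorph_prod; apply: eq_bigr => i _; rewrite mxE.
rewrite -[X in mtensor (_ *m X) 1]trmxK -(eq_tdot (tact_mtensor _ _ _) (fun _ => erefl)).
rewrite /tensor_val exchange_big; apply: eq_bigr => a _ /=.
rewrite /tact mulr_suml; apply: eq_bigr => b _; rewrite HtensorE -mul_mpolyC.
rewrite rmorphM /= !mtC mulrC mulrA; congr (_ * _ * _).
by apply: eq_bigr => j _; rewrite mxE.
Qed.

Definition var2 (j : 'I_n.*2) : L := 'X_(half_pos j).

(* At T = P^T *m diag_mx x *m P^-T, where P is a symplectic basis and x has    *)
(* the entries X_1, 1, X_2, 1, ..., the operator T^* T has the eigenvalues     *)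
(* X_1, X_1, X_2, X_2, ...                                                     *)
Lemma exists_cycle_point : exists T : 'M[L]_(n.*2), forall s,
  tensor_val (Htensor H s) T = \prod_(C in porbits s) (2%:R * psum k n #|C|).
Proof.
have [P uP PHP] := symplectic_basis (two_neq0 char_k) skH uH.
have [HE DE] := symplectic_metric uH uP PHP.
have similar (A B S J : 'M[L]_(n.*2)) : A *m B = 1%:M -> S^T = S ->
    (A^T *m S *m B^T)^T *m (B *m J *m B^T) *m (A^T *m S *m B^T) =
    B *m (S *m J *m S) *m B^T.
  move=> AB tS; have BA : B^T *m A^T = 1%:M by rewrite -trmx_mul AB trmx1.
  rewrite !trmx_mul !trmxK tS -!mulmxA (mulmxA A B) AB mul1mx.
  by rewrite (mulmxA B^T A^T) BA mul1mx.
pose c := map_mx (@mpolyC n k : {rmorphism k -> L}).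
pose Q := c _ _ P; pose I := c _ _ (invmx P).
have QI : Q *m I = 1%:M by rewrite -map_mxM mulmxV // map_mx1.
have JC : c _ _ (Jmx n k) = Jmx n L by rewrite /c Jmx_map.
pose E : 'M[L]_(n.*2) := diag_mx (\row_j if odd j then 1 else var2 j).
(* [Jmx] couples the two coordinates of a pair, whose entries in [E] are a variable and 1. *)
have EJE : E *m Jmx n L *m E = diag_mx (\row_j var2 j) *m Jmx n L.
  apply/matrixP => i j; rewrite mul_mx_diag !mul_diag_mx !mxE.
  case: eqP => [hij|_]; last by rewrite !mulr0 mul0r.
  rewrite /var2 -hij; case: (odd i); case: (odd j);
    by rewrite ?subrr ?mulr0 ?mul0r ?mul1r ?mulr1 // mulrC.
have EJEJ : E *m Jmx n L *m E *m (Jmx n L)^T = diag_mx (\row_j var2 j).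
  by rewrite EJE -mulmxA Jmx_orth mulmx1.
exists (Q^T *m E *m I^T) => s; rewrite tensor_val_Htensor.
have HI : map_mx (@mpolyC n k) H = I *m Jmx n L *m I^T.
  by rewrite {1}HE 2!map_mxM -map_trmx /= -JC.
rewrite HI (similar _ _ _ _ QI) ?tr_diag_mx //.
rewrite -(eq_tdot (tact_mtensor _ _ _) (fun _ => erefl)) tdot_act.
rewrite (eq_tdot (fun _ => erefl) (tact_mtensor _ _ _)).
have -> : map_mx (@mpolyC n k) D = Q^T *m Jmx n L *m Q.
  by rewrite /D DE 2!map_mxM -map_trmx /= -JC.
have ItQt : I^T *m Q^T = 1%:M by rewrite -trmx_mul QI trmx1.
have -> : I^T *m (Q^T *m Jmx n L *m Q) *m I^T^T = Jmx n L.
  by rewrite trmxK -!mulmxA QI mulmx1 (mulmxA I^T) ItQt mul1mx.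
rewrite (tdot_mtensor_diag _ EJEJ); apply: eq_bigr => C _.
rewrite big_pos /= /psum mulr_natl mulr2n -big_split; apply: eq_bigr => l _ /=.
by rewrite !mxE /var2 half_pos1 half_pos2.
Qed.

(** Exponents of the product of power sums attached to [s]; the variable [j] stands for the power
    sum of degree [j.+1]. *)
Definition cycle_mnm s : 'X_{1..n} :=
  [multinom #|[set C in porbits s | #|C| == j.+1]| | j < n].

Lemma prod_cycles_psums s : (forall C, C \in porbits s -> #|C| <= n)%N ->
  \prod_(C in porbits s) (2%:R * psum k n #|C|) =
  (2%:R ^+ #|porbits s|) *: ('X_[cycle_mnm s] \mPo psums k n).
Proof.
move=> sn; rewrite big_split /= prodr_const -mul_mpolyC rmorphXn rmorph_nat.
congr (_ * _); rewrite comp_mpolyX.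
rewrite (prod_by_size (n := n) (sz := fun C : {set 'I_m} => #|C|)).
  by apply: eq_bigr => j _; rewrite tnth_mktuple mnmE.
move=> C Cs; rewrite sn // andbT lt0n.
by case/imsetP: Cs => i _ ->; apply: card_porbit_neq0.
Qed.

Lemma cycle_mnm_conj s t :
    (forall C, C \in porbits s -> #|C| <= n)%N ->
    (forall C, C \in porbits t -> #|C| <= n)%N ->
  cycle_mnm s = cycle_mnm t -> exists x, t = (s ^ x)%g.
Proof.
move=> sn tn st; apply: cycle_type_conj; apply/allP => l _ /=; apply/eqP.
have cE u : count_mem l (cycle_type u) = #|[set C in porbits u | #|C| == l]|.
  by rewrite count_map -sum1_count big_enum_cond sum1dep_card; apply: eq_card => C; rewrite !inE.
rewrite !cE; have [/andP[l0 ln]|ln] := boolP (0 < l <= n)%N.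
  have ln' : (l.-1 < n)%N by rewrite prednK.
  have /mnmP/(_ (Ordinal ln')) := st.
  by rewrite !mnmE /= prednK.
have c0 (u : 'S_m) : (forall C, C \in porbits u -> #|C| <= n)%N ->
    [set C in porbits u | #|C| == l] = set0.
  move=> un; apply/setP => C; rewrite !inE; apply/negP => /andP[Cu /eqP Cl].
  case/negP: ln; rewrite -Cl un // andbT lt0n.
  by case/imsetP: Cu => i _ ->; apply: card_porbit_neq0.
by rewrite !c0.
Qed.

Lemma rep_spec (i : 'I_#|Sprime n m|) :
  (forall C, C \in porbits (rep i) -> #|C| <= n)%N /\
  enum_val i = (rep i ^: [set: 'S_m])%g.
Proof.
have /imsetP[s] := enum_valP i; rewrite inE => /forall_inP sn iE.
have [x xE] := rep_conj iE; split=> [_ /imsetP[y _ ->]|]; last first.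
  by rewrite iE xE classGidl ?inE.
have -> : porbit (rep i) y = x @: porbit s ((x^-1)%g y).
  apply/setP => z; apply/porbitP/imsetP => [[l ->]|[w /porbitP[l ->] ->]].
    exists ((s ^+ l)%g ((x^-1)%g y)); first exact: mem_porbit.
    by rewrite xE -conjXg -{1}[y](permKV x) permJ.
  by exists l; rewrite xE -conjXg -{2}[y](permKV x) permJ.
rewrite card_imset; last exact: perm_inj.
by apply: sn; apply: imset_f.
Qed.

(** At the point of [exists_cycle_point] a linear relation becomes a polynomial relation between n
    power sums, in which distinct classes give distinct monomials. *)
Lemma symmetrize_Htensor_free (c : 'I_#|Sprime n m| -> k) :
  (forall b a, \sum_i c i * symmetrize (Htensor H (rep i)) b a = 0) ->
  forall i, c i = 0.
Proof.
move=> c0; have [T TE] := exists_cycle_point.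
pose e i : k := c i * 2%:R ^+ #|porbits (rep i)|.
pose F : L := \sum_i e i *: 'X_[cycle_mnm (rep i)].
have F0 : F = 0.
  apply: (psums_free char_k); rewrite /F raddf_sum /=.
  transitivity (\sum_i c i *: tensor_val (symmetrize (Htensor H (rep i))) T).
    apply: eq_bigr => i _; rewrite comp_mpolyZ -scalerA -prod_cycles_psums.
      by rewrite tensor_val_symmetrize TE.
    by have [] := rep_spec i.
  rewrite -tensor_val_sum /tensor_val big1 // => b _; rewrite big1 // => a _.
  by rewrite c0 scale0r.
move=> i; have /(congr1 (mcoeff (cycle_mnm (rep i)))) := F0.
rewrite mcoeff0 raddf_sum (bigD1 i) //= big1 => [|j ji]; last first.
  rewrite mcoeffZ mcoeffX; case: eqP => [ij|]; last by rewrite mulr0.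
  have [jn jE] := rep_spec j; have [iN iE] := rep_spec i.
  have [x xE] := cycle_mnm_conj jn iN ij.
  case/eqP: ji; apply: enum_val_inj; rewrite jE iE xE.
  by rewrite classGidl ?inE.
rewrite addr0 mcoeffZ mcoeffX eqxx mulr1 => /eqP.
by rewrite mulf_eq0 expf_eq0 (negbTE (two_neq0 char_k)) andbF orbF => /eqP.
Qed.

End LinearIndependence.

(** * The coefficients of the series *)

Section Pairing.

Variables (k : fieldType) (N r : nat).
Hypothesis char_k : [pchar k] =i pred0.
Implicit Types t z : tensor k N r.

(** The duality between functions and tensors of endomorphisms: the indices of [z] are exchanged
    because the form of index (b, a) reads the entry in row b and column a. *)
Definition tpair t z : k := \sum_b \sum_a t b a * z a b.

Lemma tpairC t z : tpair t z = tpair z t.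
Proof.
by rewrite /tpair exchange_big; apply: eq_bigr => b _; apply: eq_bigr => a _;
  rewrite mulrC.
Qed.

Lemma eq_tpair t t' z : t =2 t' -> tpair t z = tpair t' z.
Proof. by move=> tt; apply: eq_bigr => b _; apply: eq_bigr => a _; rewrite tt. Qed.

Lemma tpair_sum (I : finType) (c : I -> k) (t : I -> tensor k N r) z :
  tpair (fun b a => \sum_i c i * t i b a) z = \sum_i c i * tpair (t i) z.
Proof.
rewrite /tpair; under [RHS]eq_bigr do rewrite mulr_sumr.
rewrite [RHS]exchange_big; apply: eq_bigr => b _ /=.
under [RHS]eq_bigr do rewrite mulr_sumr.
rewrite [RHS]exchange_big; apply: eq_bigr => a _ /=.
by rewrite mulr_suml; apply: eq_bigr => i _; rewrite mulrA.
Qed.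

Lemma tpair_symmetrize t z : tsym z -> tpair (symmetrize t) z = tpair t z.
Proof.
move=> symz; transitivity (r`!%:R^-1 * \sum_(s : 'S_r) tpair t z).
  rewrite /tpair /symmetrize.
  under eq_bigr do under eq_bigr do rewrite -mulrA mulr_suml.
  under eq_bigr do rewrite -mulr_sumr exchange_big.
  rewrite -mulr_sumr exchange_big; congr (_ * _); apply: eq_bigr => s _ /=.
  rewrite [RHS](reindex_inj (@mindex_perm_inj _ _ s)); apply: eq_bigr => b _ /=.
  rewrite [RHS](reindex_inj (@mindex_perm_inj _ _ s)); apply: eq_bigr => a _ /=.
  by rewrite symz.
rewrite sumr_const card_Sn -[X in _ * X]mulr_natl mulrA mulVf ?mul1r //.
by rewrite ((pcharf0P k).1 char_k) -lt0n fact_gt0.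
Qed.

Lemma symmetrize_id t : tsym t -> symmetrize t =2 t.
Proof.
move=> symt b a; rewrite /symmetrize (eq_bigr (fun=> t b a)) => [|s _].
  rewrite sumr_const card_Sn -[t b a *+ _]mulr_natl mulrA mulVf ?mul1r //.
  by rewrite ((pcharf0P k).1 char_k) -lt0n fact_gt0.
exact: symt.
Qed.

Lemma tensor_form_poly t z : tsym z -> tensor_form z (tensor_poly t) = tpair t z.
Proof.
move=> symz; have hS I q P F := @scalar_form_sum _ _ _ I q P F (tensor_form_scalar z).
have hZ c q := scalar_formZ c q (tensor_form_scalar z).
rewrite /tensor_poly hS; apply: eq_bigr => b _; rewrite hS.
apply: eq_bigr => a _; rewrite hZ -(tensor_form_mono a b char_k symz).
by rewrite mpolyX_mono.
Qed.

Lemma tensor_form_sum (I : finType) (c : I -> k) (t : I -> tensor k N r) p :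
  tensor_form (fun b a => \sum_i c i * t i b a) p = \sum_i c i * tensor_form (t i) p.
Proof.
rewrite /tensor_form; under [RHS]eq_bigr do rewrite mulr_sumr.
rewrite [RHS]exchange_big; apply: eq_bigr => b _ /=.
under [RHS]eq_bigr do rewrite mulr_sumr.
rewrite [RHS]exchange_big; apply: eq_bigr => a _ /=.
by rewrite mulr_suml; apply: eq_bigr => i _; rewrite -mulrA.
Qed.

Lemma eq_tensor_form t z p : t =2 z -> tensor_form t p = tensor_form z p.
Proof. by move=> tz; apply: eq_bigr => b _; apply: eq_bigr => a _; rewrite tz. Qed.

Lemma symmetrize_sum (I : finType) (c : I -> k) (t : I -> tensor k N r) b a :
  symmetrize (fun b a => \sum_i c i * t i b a) b a = \sum_i c i * symmetrize (t i) b a.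
Proof.
rewrite /symmetrize exchange_big mulr_sumr; apply: eq_bigr => i _ /=.
by rewrite -mulr_sumr mulrCA.
Qed.

End Pairing.

(** * The linear system for the coefficients *)

Section GramMatrix.

Variables (k : fieldType) (n m : nat) (H : 'M[k]_(n.*2)).
Hypotheses (char_k : [pchar k] =i pred0) (n_gt0 : (0 < n)%N).
Hypotheses (skH : H^T = - H) (uH : H \in unitmx).
Let D := dual_metric H.
Variable t : tensor k n.*2 m.*2.
Hypothesis ht : haar_tensor H t.
Implicit Types s : 'S_m.

Local Notation symH s := (symmetrize (Htensor H s)).
Local Notation N := ((n.*2)%:R : k).

Lemma dim_neq0 : N != 0.
Proof. by rewrite ((pcharf0P k).1 char_k) double_eq0 -lt0n. Qed.

Lemma pair_tensor_sign (y x : 'S_m.*2) : exists e s,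
  symmetrize (pair_tensor H y x) =2 fun b a => e * symH s b a.
Proof.
have [i|i|s _ sE] := @matching_normal_form _ _ _ skH uH _ setT (x * y^-1)%g 1.
- by rewrite !inE.
- by rewrite inE.
exists ((-1) ^+ odd_perm (x * y^-1)%g * (-1) ^+ odd_perm s), s => b a.
rewrite -mulrA -sE mulrA -signr_addb addbb mul1r.
by rewrite -[RHS](symmetrize_pair_perm _ _ _ y) mul1g mulgKV.
Qed.

(** The projector is symmetric, hence equal to its symmetrization, and each symmetrized pair of
    matchings is a multiple of some [symH s]. *)
Lemma short_span_haar : exists d : 'I_#|Sprime n m| -> k, forall b a,
  t b a = \sum_i d i * symH (rep i) b a.
Proof.
have symt : tsym t by move=> s b a; apply: (haar_tensor_sym _ _ _ ht).
have [[C tE] _ _] := ht.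
pose c (zy : 'S_m.*2 * 'S_m.*2) := C zy.2 zy.1.
have tE' : t =2 fun b a => \sum_zy c zy * pair_tensor H zy.1 zy.2 b a.
  move=> b a; rewrite tE exchange_big pair_bigA; apply: eq_bigr => zy _.
  by rewrite /pair_tensor mulrA.
have [d dE] : short_span H (fun b a => \sum_zy c zy * symmetrize (pair_tensor H zy.1 zy.2) b a).
  apply: short_span_sum => zy _; have [e [s es]] := pair_tensor_sign zy.1 zy.2.
  have [d dE] := symmetrize_Htensor_span char_k skH uH s.
  exists (fun i => e * d i) => b a; rewrite es dE mulr_sumr.
  by apply: eq_bigr => i _; rewrite mulrA.
exists d => b a; rewrite -dE -symmetrize_sum -(eq_symmetrize tE').
by rewrite symmetrize_id.
Qed.

Lemma w_a s s' : w_ H s (a_ H s') = tpair (symH s') (symH s).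
Proof.
rewrite /w_ /a_ tensor_form_poly //; last exact: symmetrize_sym.
by rewrite tpair_symmetrize //; apply: symmetrize_sym.
Qed.

(** Since the projector fixes the copies of [H], the value is the contraction of [H] with [D] along
    the matchings, and every cycle of [s] contributes the trace of the identity. *)
Lemma haar_a s : tensor_form t (a_ H s) = N ^+ ncycles s.
Proof.
have symt : tsym t by move=> x b a; apply: (haar_tensor_sym _ _ _ ht).
have [_ _ tH] := ht.
rewrite /a_ tensor_form_poly // /tpair exchange_big /=.
transitivity (tdot (mtensor H 1) (mtensor D (bipos 1 s))).
  apply: eq_bigr => a _; rewrite -tH mulr_suml; apply: eq_bigr => b _.
  by rewrite HtensorE mulrC mulrA.
rewrite (@tdot_mtensor_diag _ _ _ _ _ (const_mx 1)).
  rewrite -prodr_const; apply: eq_bigr => C _.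
  under eq_bigr do rewrite mxE expr1n.
  by rewrite sumr_const card_ord.
by rewrite diag_const_mx /D /dual_metric trmxK mulmxV.
Qed.

(* A symmetric combination z of the w_s orthogonal to all the a_s vanishes:   *)
(* projecting both factors of z by t writes z in terms of these products.     *)
Lemma w_a_nondegenerate (c : 'I_#|Sprime n m| -> k) :
    (forall j : 'I_#|Sprime n m|, \sum_i c i * w_ H (rep i) (a_ H (rep j)) = 0) ->
  forall i, c i = 0.
Proof.
move=> c0; pose z : tensor k n.*2 m.*2 := fun b a => \sum_i c i * symH (rep i) b a.
have symz : tsym z.
  by move=> s b a; apply: eq_bigr => i _; rewrite symmetrize_sym.
have pair0 s : tpair (symH s) z = 0.
  have [d dE] := symmetrize_Htensor_span char_k skH uH s.
  rewrite (eq_tpair _ dE) tpair_sum big1 // => j _.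
  rewrite tpairC tpair_sum -[X in _ * X](_ : 0 = _) ?mulr0 // -[LHS](c0 j).
  by apply: eq_bigr => i _; rewrite w_a tpairC.
have pairz y x : tpair (pair_tensor H y x) z = 0.
  rewrite -tpair_symmetrize //; have [e [s es]] := pair_tensor_sign y x.
  rewrite (eq_tpair _ es).
  transitivity (e * tpair (symH s) z); last by rewrite pair0 mulr0.
  rewrite /tpair mulr_sumr; apply: eq_bigr => b _; rewrite mulr_sumr.
  by apply: eq_bigr => a _; rewrite mulrA.
apply: (symmetrize_Htensor_free char_k skH uH) => b a; rewrite -/(z b a).
pose I : finType := ('I_#|Sprime n m| * 'S_m.*2)%type.
have zE b' a' : z b' a' = \sum_(xs : I) (c xs.1 / (m.*2)`!%:R) *
    (mtensor H xs.2 b' * mtensor D (bipos 1 (rep xs.1) * xs.2)%g a').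
  rewrite /z -(pair_bigA _ (fun i (s : 'S_m.*2) => (c i / (m.*2)`!%:R) *
    (mtensor H s b' * mtensor D (bipos 1 (rep i) * s)%g a'))) /=.
  apply: eq_bigr => i _; rewrite /symmetrize mulrA mulr_sumr; apply: eq_bigr => s _.
  by rewrite HtensorE /pair_tensor !mtensor_perm mul1g.
have zD b' a' : \sum_a t a a' * z b' a = z b' a'.
  apply: (haar_tensor_fixD ht (I := I) (e := fun xs => c xs.1 / (m.*2)`!%:R * mtensor H xs.2 b')
    (x := fun xs => (bipos 1 (rep xs.1) * xs.2)%g)) => a''.
  by rewrite zE; apply: eq_bigr => xs _; rewrite mulrA.
have zH b' a' : \sum_b t b' b * z b a' = z b' a'.
  apply: (haar_tensor_fixH ht (I := I) (x := fun xs => xs.2)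
    (e := fun xs => c xs.1 / (m.*2)`!%:R * mtensor D (bipos 1 (rep xs.1) * xs.2)%g a')) => b''.
  by rewrite zE; apply: eq_bigr => xs _; rewrite [RHS]mulrAC mulrA.
have [e eE] := haar_tensor_rowD ht b; have [g gE] := haar_tensor_colH ht a.
transitivity (tpair (fun a' b' => \sum_(xy : 'S_m.*2 * 'S_m.*2)
    (g xy.1 * e xy.2) * pair_tensor H xy.1 xy.2 a' b') z); last first.
  by rewrite tpair_sum big1 // => xy _; rewrite pairz mulr0.
rewrite -zD; apply: eq_bigr => a' _; rewrite -zH mulr_sumr; apply: eq_bigr => b' _.
rewrite mulrA; congr (_ * _); rewrite eE gE mulr_suml.
rewrite -(pair_bigA _ (fun x y => g x * e y * pair_tensor H x y a' b')) /=.
apply: eq_bigr => x _; rewrite mulr_sumr; apply: eq_bigr => y _.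
by rewrite /pair_tensor mulrACA.
Qed.

Lemma lambda_mx_sym : (lambda_mx H m)^T = lambda_mx H m.
Proof.
apply/matrixP => i j; rewrite !mxE !w_a tpairC; congr (_ / _).
by rewrite mulrC.
Qed.

(** A kernel vector, rescaled by powers of 2n, is a combination of the [w_ s] that vanishes at all
    the [a_ s']. *)
Lemma lambda_mx_unit : lambda_mx H m \in unitmx.
Proof.
rewrite -row_free_unit -kermx_eq0; apply/eqP/row_matrixP => l; rewrite row0.
set v := row l _; have vL : v *m lambda_mx H m = 0 by rewrite -row_mul mulmx_ker row0.
have N0 s : N ^+ ncycles s != 0 by rewrite expf_neq0 ?dim_neq0.
have c0 := @w_a_nondegenerate (fun i => v 0 i / N ^+ ncycles (rep i)).
apply/rowP => i; rewrite [RHS]mxE.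
suff /eqP : v 0 i / N ^+ ncycles (rep i) = 0.
  by rewrite mulf_eq0 invr_eq0 (negbTE (N0 _)) orbF => /eqP.
apply: c0 => j; have /rowP/(_ j) := vL; rewrite !mxE => vLj.
apply: (mulIf (invr_neq0 (N0 (rep j)))); rewrite mul0r -[RHS]vLj mulr_suml.
apply: eq_bigr => i' _; rewrite [lambda_mx _ _ _ _]mxE invfM.
by rewrite [v 0 i' / _ * _]mulrAC !mulrA.
Qed.

(** Evaluating an expansion of the projector at the [a_ s] and dividing by [haar_a] gives the system
    whose right-hand side is constant equal to 1. *)
Lemma haar_form_lambda p : tensor_form t p =
  \sum_i lambda H m i 0 * (w_ H (rep i) p / N ^+ ncycles (rep i)).
Proof.
have [d dE] := short_span_haar.
have tE q : tensor_form t q = \sum_i d i * w_ H (rep i) q.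
  by rewrite (eq_tensor_form _ dE) tensor_form_sum.
have N0 s : N ^+ ncycles s != 0 by rewrite expf_neq0 ?dim_neq0.
pose u : 'cV[k]_#|Sprime n m| := \col_i (d i * N ^+ ncycles (rep i)).
have Lu : lambda_mx H m *m u = const_mx 1.
  apply/colP => j; rewrite -lambda_mx_sym !mxE.
  rewrite -[RHS](divff (N0 (rep j))) -[X in X / _]haar_a tE mulr_suml.
  apply: eq_bigr => i _; rewrite !mxE invfM.
  rewrite mulrC -!mulrA; congr (_ * _).
  by rewrite mulrCA; congr (_ * _); rewrite mulrA mulfV ?mul1r.
have -> : lambda H m = u by rewrite /lambda -Lu mulKmx // lambda_mx_unit.
rewrite tE; apply: eq_bigr => i _.
by rewrite mxE mulrACA mulfV // mulr1.
Qed.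

End GramMatrix.

(** * From the form on the vector space to its Gram matrix *)

Section Gram.

Variables (k : fieldType) (N : nat) (E : vectType k) (e : N.-tuple E).
Hypothesis e_basis : basis_of fullv e.
Variable H : {skew_symmetric E}.

Lemma gram_skew : (gram H e)^T = - gram H e.
Proof.
by apply/matrixP => i j; rewrite !mxE hermC /= expr1 mulN1r.
Qed.

Lemma gram_unit : nondegenerate H -> gram H e \in unitmx.
Proof.
move=> /eqP Hnd; rewrite -row_free_unit -kermx_eq0; apply/eqP/row_matrixP => l.
rewrite row0; set v := row l _.
have vG : v *m gram H e = 0 by rewrite -row_mul mulmx_ker row0.
pose x := \sum_i v 0 i *: tnth e i.
have Hx j : H x (tnth e j) = 0.
  have /rowP/(_ j) := vG; rewrite !mxE => <-; rewrite /x linear_sumlz.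
  by apply: eq_bigr => i _; rewrite linearZl_LR [gram _ _ _ _]mxE !mxE.
have : x \in orthov H fullv.
  apply/mem_orthovP => y _; rewrite (coord_basis e_basis (memvf y)) linear_sumr big1 // => j _.
  by rewrite linearZr_LR /= -tnth_nth Hx mulr0.
rewrite Hnd memv0 => /eqP x0; apply/rowP => i; rewrite [RHS]mxE.
have /freeP/(_ (fun i => v 0 i)) := basis_free e_basis; apply.
by rewrite -[RHS]x0; apply: eq_bigr => j _; rewrite -tnth_nth.
Qed.

End Gram.

Theorem mainTheorem9 (k : fieldType) (char_k : [pchar k] =i pred0)
    (n : nat) (n_gt0 : (0 < n)%N)
    (E : vectType k) (e : (n.*2).-tuple E) (e_basis : basis_of fullv e)
    (H : {skew_symmetric E}) (H_nondeg : nondegenerate H) :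
  [/\ forall m : nat, (0 < m)%N -> lambda_mx (gram H e) m \in unitmx,
      invariant_integral (gram H e) (w_series (gram H e))
    & forall w : {mpoly k[n.*2 * n.*2]} -> k,
        invariant_integral (gram H e) w -> w =1 w_series (gram H e)].
Proof.
have skG := gram_skew e H; have uG := gram_unit e_basis H_nondeg.
set G := gram H e in skG uG *.
pose tP m := cid (haar_tensor_exists m char_k skG uG).
pose t m := sval (tP m).
have ht m : haar_tensor G (t m) := svalP (tP m).
have wE : w_series G = haar_form t.
  (* At [p = 0] the sum defining [haar_form] is empty and has no constant term to split off. *)
  apply: funext => p; have [->|p0] := eqVneq p 0.
    by rewrite /w_series /haar_form msize0 big_ord0 big_geq // addr0 mcoeff0.
  have sp : (0 < msize p)%N by rewrite lt0n msize_poly_eq0.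
  rewrite /w_series /haar_form -(big_mkord xpredT (fun m => tensor_form (t m) p)).
  rewrite big_ltn //; congr (_ + _).
    (* The projector of degree 0 is the number 1, so its form reads off the constant coefficient. *)
    apply: (eq_scalar_form (w := mcoeff 0%MM)); first 1 last.
    - exact: tensor_form_scalar.
    - move=> u; rewrite mcoeffX; have [->|u0] := eqVneq u 0%MM; last first.
        by rewrite tensor_form_deg // mdeg_eq0.
      rewrite mpolyX0 -(haar_form1 char_k ht) /haar_form msize1.
      by rewrite big_ord_recl big_ord0 addr0.
    - by move=> c q r; rewrite mcoeffD mcoeffZ.
  by apply: eq_bigr => m _; rewrite (haar_form_lambda char_k n_gt0 skG uG (ht m)).
rewrite wE; split=> [m _||w]; first by apply: (lambda_mx_unit char_k n_gt0 skG uG (ht m)).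
  exact: haar_form_invariant.
exact: invariant_integral_unique.
Qed.
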